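(* The following maps provide isomorphisms of representations of $\mathcal B$ between $(\pi,\mathcal H)$ and $(\pi',\mathcal H')$, and between $(\pi,\mathcal H)$ and $({}'\pi,{}'\mathcal H)$, where each map is defined on a dense subspace of $L^2(\mathbb R)$ (e.g. on $W$): $$C':\mathcal H\to\mathcal H',\quad (C'f)(y)=\int_{\mathbb R}k(x,y)f(x)\,dx,\qquad D':\mathcal H'\to\mathcal H,\quad (D'\varphi)(x)=\int_{\mathbb R}K(x,y)\varphi(y)\,dy,$$ $${}'C:\mathcal H\to{}'\mathcal H,\quad ({}'Cf)(z)=\int_{\mathbb R}k(z,x)f(x)\,dx,\qquad {}'D:{}'\mathcal H\to\mathcal H,\quad ({}'D\varphi)(x)=\int_{\mathbb R}K(z,x)\varphi(z)\,dz.$$ Furthermore, $$(D')(C')=(C')(D')=({}'D)({}'C)=({}'C)({}'D)=\mathrm{id}.$$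
   Context: Fix $b\in(0,\infty)$ with $b^2\notin\mathbb Q$; put $q=e^{\pi i b^2}$, $\widetilde q=e^{\pi i b^{-2}}$, $a=(b+b^{-1})/2$. $\mathcal B$ is the algebra generated by $X,Y,\widetilde X,\widetilde Y$ with $XY=q^2YX$, $\widetilde X\widetilde Y=\widetilde q^{\,2}\widetilde Y\widetilde X$, and $X,Y$ commuting with $\widetilde X,\widetilde Y$ (a subalgebra of a Hopf $*$-algebra with antipode $S(X)=X^{-1}$, $S(Y)=-YX^{-1}$ and likewise with tildes). Let $p=\frac{1}{2\pi i}\frac{d}{dx}$, so $(e^{-2\pi cp}f)(x)=f(x+ic)$. The spaces $\mathcal H,\mathcal H',{}'\mathcal H$ are all realized as $L^2(\mathbb R)$ (variables $x,y,z$ respectively), with the following densely defined actions of $\mathcal B$ (in each case $p$ and $x$ denote $\frac1{2\pi i}$ times the derivative and multiplication with respect to the variable of the space): $$\pi(X)=e^{-2\pi bp},\quad \pi(Y)=e^{2\pi bx},\quad \pi(\widetilde X)=e^{-2\pi b^{-1}p},\quad \pi(\widetilde Y)=e^{2\pi b^{-1}x};$$ $$\pi'(X)=e^{-2\pi bp},\quad \pi'(Y)=-e^{-2\pi bp}e^{2\pi bx},\quad \pi'(\widetilde X)=e^{-2\pi b^{-1}p},\quad \pi'(\widetilde Y)=-e^{-2\pi b^{-1}p}e^{2\pi b^{-1}x};$$ $${}'\pi(X)=e^{-2\pi bp},\quad {}'\pi(Y)=-e^{2\pi bx}e^{-2\pi bp},\quad {}'\pi(\widetilde X)=e^{-2\pi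 b^{-1}p},\quad {}'\pi(\widetilde Y)=-e^{2\pi b^{-1}x}e^{-2\pi b^{-1}p}.$$ (These $\pi'$, ${}'\pi$ are the right and left dual representations, formally the transposes of $\pi\circ S$ and $\pi\circ S^{-1}$.) All actions are first defined on $W$, the dense space of finite linear combinations of $e^{-Ax^2/2+Bx}P(x)$ with $A>0$, $B\in\mathbb C$, $P$ a polynomial, and then on the corresponding Schwartz space, e.g. for $\pi$ the space of $f\in L^2(\mathbb R)$ such that $w\mapsto(f,\pi(u)w)$ is $L^2$-continuous on $W$ for all $u\in\mathcal B$. Kernels: $$k(x,y)=e^{\pi i(x-y)^2+2\pi a(x-y)},\qquad K(x,y)=e^{-\pi i(x-y)^2-2\pi a(x-y)}.$$ *)

(* Defs.v *)
From HB Require Import structures.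
From mathcomp Require Import all_boot all_order all_algebra.
From mathcomp Require Import complex ring.
From mathcomp Require Import all_classical all_reals all_analysis.

Set Implicit Arguments.
Unset Strict Implicit.
Unset Printing Implicit Defensive.

Import Order.TTheory GRing.Theory Num.Theory.
Import numFieldNormedType.Exports.

Local Open Scope classical_set_scope.
Local Open Scope complex_scope.
Local Open Scope ring_scope.
Local Open Scope quotient_scope.

Section ComplexFunctions.
Variable R : realType.
Local Notation C := R[i].
Local Notation mu := (@lebesgue_measure R).

Definition cexp (z : C) : C :=
  (expR (complex.Re z))%:C * (cos (complex.Im z) +i* sin (complex.Im z)).

Definition cintegrable (f : R -> C) : Prop :=
  mu.-integrable setT (EFin \o (fun x => complex.Re (f x))) /\
  mu.-integrable setT (EFin \o (fun x => complex.Im (f x))).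

Definition cint (f : R -> C) : C :=
  (\int[mu]_x complex.Re (f x))%R +i* (\int[mu]_x complex.Im (f x))%R.

(* Elements of L^2(R) are represented by functions; equality in L^2(R) is
   equality almost everywhere. *)
Definition L2 (f : R -> C) : Prop :=
  ((fun x => complex.Re (f x)) \in Lfun mu 2%:E) /\
  ((fun x => complex.Im (f x)) \in Lfun mu 2%:E).

Definition L2norm (f : R -> C) : R :=
  fine (Lnorm mu 2%:E (fun x => (Normc.normc (f x))%:E)).

Definition L2inner (f g : R -> C) : C := cint (fun x => f x * (g x)^*).

Definition L2dense (D : set (R -> C)) : Prop :=
  forall f, L2 f -> forall e : R, 0 < e ->
    exists2 g, D g & L2norm (fun x => f x - g x) < e.

(* The elements of W are kept as entire functions, because e^{-2 pi c p}
   evaluates them off the real line; onR is the restriction to R. *)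
Definition onR (f : C -> C) : R -> C := fun x => f x%:C.

Definition W : set (C -> C) := [set f |
  exists s : seq (R * C * {poly C}),
    all (fun t => 0 < t.1.1) s /\
    f = fun z => \sum_(t <- s)
          cexp (- (t.1.1)%:C * z ^+ 2 / 2 + t.1.2 * z) * (t.2).[z] ].

End ComplexFunctions.

Section NcExpr.
Variable K : Type.

(* noncommutative polynomial expressions in the generators G *)
Inductive ncexpr (G : Type) : Type :=
| Scal of K
| Gen of G
| Add of ncexpr G & ncexpr G
| Mul of ncexpr G & ncexpr G.

Fixpoint subst (G H : Type) (s : G -> ncexpr H) (e : ncexpr G) : ncexpr H :=
  match e with
  | Scal c => Scal H c
  | Gen g => s g
  | Add u v => Add (subst s u) (subst s v)
  | Mul u v => Mul (subst s u) (subst s v)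
  end.

End NcExpr.
Arguments Scal {K G}.
Arguments Gen {K G}.

HB.instance Definition _ (K G : Type) := gen_eqMixin (ncexpr K G).
HB.instance Definition _ (K G : Type) := gen_choiceMixin (ncexpr K G).

Section AlgebraB.
Variable R : realType.
Local Notation C := R[i].

Inductive Bgen := GX | GY | GXt | GYt.

Local Notation E := (ncexpr C Bgen).

Variable b : R.

Definition qpar : C := cexp ((pi * b ^+ 2) *i).
Definition qtpar : C := cexp ((pi * (b ^-1) ^+ 2) *i).

(* The congruence on expressions generated by the axioms of a unital
   associative C-algebra and the defining relations of B. *)
Inductive Beq : E -> E -> Prop :=
| Beq_refl u : Beq u u
| Beq_sym u v : Beq u v -> Beq v u
| Beq_trans u v w : Beq u v -> Beq v w -> Beq u w
| Beq_add u u' v v' : Beq u u' -> Beq v v' -> Beq (Add u v) (Add u' v')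
| Beq_mul u u' v v' : Beq u u' -> Beq v v' -> Beq (Mul u v) (Mul u' v')
| Beq_addA u v w : Beq (Add u (Add v w)) (Add (Add u v) w)
| Beq_addC u v : Beq (Add u v) (Add v u)
| Beq_add0 u : Beq (Add (Scal 0) u) u
| Beq_addN u : Beq (Add (Mul (Scal (-1)) u) u) (Scal 0)
| Beq_mulA u v w : Beq (Mul u (Mul v w)) (Mul (Mul u v) w)
| Beq_mul1 u : Beq (Mul (Scal 1) u) u
| Beq_mulDl u v w : Beq (Mul (Add u v) w) (Add (Mul u w) (Mul v w))
| Beq_mulDr u v w : Beq (Mul u (Add v w)) (Add (Mul u v) (Mul u w))
| Beq_scalD c d : Beq (Scal (c + d)) (Add (Scal c) (Scal d))
| Beq_scalM c d : Beq (Scal (c * d)) (Mul (Scal c) (Scal d))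
| Beq_central c u : Beq (Mul (Scal c) u) (Mul u (Scal c))
| Beq_XY : Beq (Mul (Gen GX) (Gen GY))
               (Mul (Scal (qpar ^+ 2)) (Mul (Gen GY) (Gen GX)))
| Beq_XtYt : Beq (Mul (Gen GXt) (Gen GYt))
                 (Mul (Scal (qtpar ^+ 2)) (Mul (Gen GYt) (Gen GXt)))
| Beq_XXt : Beq (Mul (Gen GX) (Gen GXt)) (Mul (Gen GXt) (Gen GX))
| Beq_XYt : Beq (Mul (Gen GX) (Gen GYt)) (Mul (Gen GYt) (Gen GX))
| Beq_YXt : Beq (Mul (Gen GY) (Gen GXt)) (Mul (Gen GXt) (Gen GY))
| Beq_YYt : Beq (Mul (Gen GY) (Gen GYt)) (Mul (Gen GYt) (Gen GY)).

Definition Bequ (u v : E) : bool := `[< Beq u v >].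

Lemma Bequ_refl : reflexive Bequ.
Proof. by move=> u; apply/asboolP/Beq_refl. Qed.

Lemma Bequ_sym : symmetric Bequ.
Proof. by move=> u v; apply/asboolP/asboolP => ?; apply: Beq_sym. Qed.

Lemma Bequ_trans : transitive Bequ.
Proof.
move=> v u w /asboolP uv /asboolP vw; apply/asboolP.
exact: Beq_trans uv vw.
Qed.

Canonical Bequ_equiv := EquivRel Bequ Bequ_refl Bequ_sym Bequ_trans.

Definition calB : Type := {eq_quot Bequ}.
HB.instance Definition _ := Choice.on calB.
HB.instance Definition _ := EqQuotient.on calB.

Definition cls (u : E) : calB := \pi_calB u.

Lemma clsP u v : cls u = cls v <-> Beq u v.
Proof.
split; first by move=> /eqmodP /asboolP.
by move=> uv; apply/eqmodP/asboolP.
Qed.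

Lemma repr_cls u : Beq (repr (cls u)) u.
Proof. by apply/clsP; rewrite /cls reprK. Qed.

Lemma cls_repr (x : calB) : cls (repr x) = x.
Proof. by rewrite /cls reprK. Qed.

Definition Badd (x y : calB) := cls (Add (repr x) (repr y)).
Definition Bmul (x y : calB) := cls (Mul (repr x) (repr y)).
Definition Bzero := cls (Scal 0).
Definition Bone := cls (Scal 1).
Definition Bopp (x : calB) := cls (Mul (Scal (-1)) (repr x)).
Definition Bscale (c : C) (x : calB) := cls (Mul (Scal c) (repr x)).

Lemma cls_add u v : Badd (cls u) (cls v) = cls (Add u v).
Proof. by apply/clsP/Beq_add; apply: repr_cls. Qed.

Lemma cls_mul u v : Bmul (cls u) (cls v) = cls (Mul u v).
Proof. by apply/clsP/Beq_mul; apply: repr_cls. Qed.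

Lemma cls_opp u : Bopp (cls u) = cls (Mul (Scal (-1)) u).
Proof. by apply/clsP/Beq_mul; [exact: Beq_refl|exact: repr_cls]. Qed.

Lemma cls_scale c u : Bscale c (cls u) = cls (Mul (Scal c) u).
Proof. by apply/clsP/Beq_mul; [exact: Beq_refl|exact: repr_cls]. Qed.

Let clsW (P : calB -> Prop) : (forall u, P (cls u)) -> forall x, P x.
Proof. by move=> H x; rewrite -(cls_repr x). Qed.

Lemma BaddA : associative Badd.
Proof.
elim/clsW=> u; elim/clsW=> v; elim/clsW=> w; rewrite !cls_add.
by apply/clsP/Beq_addA.
Qed.

Lemma BaddC : commutative Badd.
Proof. by elim/clsW=> u; elim/clsW=> v; rewrite !cls_add; apply/clsP/Beq_addC. Qed.

Lemma Badd0 : left_id Bzero Badd.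
Proof. by elim/clsW=> u; rewrite cls_add; apply/clsP/Beq_add0. Qed.

Lemma BaddN : left_inverse Bzero Bopp Badd.
Proof. by elim/clsW=> u; rewrite cls_opp cls_add; apply/clsP/Beq_addN. Qed.

HB.instance Definition _ :=
  GRing.isZmodule.Build calB BaddA BaddC Badd0 BaddN.

Lemma BmulA : associative Bmul.
Proof.
elim/clsW=> u; elim/clsW=> v; elim/clsW=> w; rewrite !cls_mul.
by apply/clsP/Beq_mulA.
Qed.

Lemma Bmul1l : left_id Bone Bmul.
Proof. by elim/clsW=> u; rewrite cls_mul; apply/clsP/Beq_mul1. Qed.

Lemma Bmul1r : right_id Bone Bmul.
Proof.
elim/clsW=> u; rewrite cls_mul; apply/clsP.
exact: Beq_trans (Beq_sym (Beq_central _ _)) (Beq_mul1 _).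
Qed.

Lemma BmulDl : left_distributive Bmul Badd.
Proof.
elim/clsW=> u; elim/clsW=> v; elim/clsW=> w; rewrite !(cls_mul, cls_add).
by apply/clsP/Beq_mulDl.
Qed.

Lemma BmulDr : right_distributive Bmul Badd.
Proof.
elim/clsW=> u; elim/clsW=> v; elim/clsW=> w; rewrite !(cls_mul, cls_add).
by apply/clsP/Beq_mulDr.
Qed.

HB.instance Definition _ :=
  GRing.Zmodule_isPzRing.Build calB BmulA Bmul1l Bmul1r BmulDl BmulDr.

(* the character of B killing the four generators *)
Fixpoint constant_term (e : E) : C :=
  match e with
  | Scal c => c
  | Gen _ => 0
  | Add u v => constant_term u + constant_term v
  | Mul u v => constant_term u * constant_term v
  end.

Lemma constant_term_Beq u v : Beq u v -> constant_term u = constant_term v.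
Proof.
elim=> //= {u v}; do ?by move=> *; ring.
- by move=> u v w _ ->.
- by move=> u u' v v' _ -> _ ->.
- by move=> u u' v v' _ -> _ ->.
Qed.

Lemma Bone_neq0 : (1 : calB) != 0.
Proof.
apply/eqP => /clsP /constant_term_Beq /= /eqP.
by rewrite oner_eq0.
Qed.

HB.instance Definition _ := GRing.PzSemiRing_isNonZero.Build calB Bone_neq0.

Lemma BscaleA c d x : Bscale c (Bscale d x) = Bscale (c * d) x.
Proof.
elim/clsW: x => u; rewrite !cls_scale; apply/clsP.
apply: Beq_trans (Beq_mulA _ _ _) _.
by apply: Beq_mul (Beq_refl _); apply/Beq_sym/Beq_scalM.
Qed.

Lemma Bscale1 : left_id 1 Bscale.
Proof. by elim/clsW=> u; rewrite cls_scale; apply/clsP/Beq_mul1. Qed.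

Lemma BscaleDr : right_distributive Bscale +%R.
Proof.
move=> c; elim/clsW=> u; elim/clsW=> v.
rewrite /+%R /= !(cls_scale, cls_add); exact/clsP/Beq_mulDr.
Qed.

Lemma BscaleDl x : {morph Bscale^~ x : c d / c + d}.
Proof.
elim/clsW: x => u c d /=; rewrite [RHS]/+%R /= !(cls_scale, cls_add).
apply/clsP; apply: Beq_trans (Beq_mulDl _ _ _).
by apply: Beq_mul (Beq_refl _); apply: Beq_scalD.
Qed.

HB.instance Definition _ := GRing.Zmodule_isLmodule.Build C calB
  BscaleA Bscale1 BscaleDr BscaleDl.

Lemma BscaleAl (c : C) (x y : calB) : c *: (x * y) = (c *: x) * y.
Proof.
elim/clsW: x => u; elim/clsW: y => v.
rewrite /*%R /*:%R /= !(cls_scale, cls_mul); exact/clsP/Beq_mulA.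
Qed.

HB.instance Definition _ := GRing.Lmodule_isLalgebra.Build C calB BscaleAl.

Lemma BscaleAr (c : C) (x y : calB) : c *: (x * y) = x * (c *: y).
Proof.
elim/clsW: x => u; elim/clsW: y => v.
rewrite /*%R /*:%R /= !(cls_scale, cls_mul); apply/clsP.
apply: Beq_trans (Beq_mulA _ _ _) _.
apply: Beq_trans (Beq_sym (Beq_mulA _ _ _)).
by apply: Beq_mul (Beq_refl _); apply: Beq_central.
Qed.

HB.instance Definition _ := GRing.Lalgebra_isAlgebra.Build C calB BscaleAr.

Definition BX : calB := cls (Gen GX).
Definition BY : calB := cls (Gen GY).
Definition BXt : calB := cls (Gen GXt).
Definition BYt : calB := cls (Gen GYt).

Lemma B_relations :
  [/\ BX * BY = qpar ^+ 2 *: (BY * BX) & BXt * BYt = qtpar ^+ 2 *: (BYt * BXt)]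
  /\ [/\ BX * BXt = BXt * BX, BX * BYt = BYt * BX,
         BY * BXt = BXt * BY & BY * BYt = BYt * BY].
Proof.
have clsM u v : cls u * cls v = cls (Mul u v) := cls_mul u v.
have clsZ c u : c *: cls u = cls (Mul (Scal c) u) := cls_scale c u.
by split; split; rewrite !clsM ?clsZ; apply/clsP; constructor.
Qed.

End AlgebraB.

Section Weyl.
Variable R : realType.
Local Notation C := R[i].

(* ExpP c stands for e^{-2 pi c p} and ExpX d for e^{2 pi d x}. *)
Inductive Wgen := ExpP of R | ExpX of R.

Local Notation V := (C -> C).

Definition wgen_op (g : Wgen) (f : V) : V :=
  match g with
  | ExpP c => fun z => f (z + c *i)
  | ExpX d => fun z => cexp ((2 * pi * d)%:C * z) * f z
  end.

Fixpoint wop (e : ncexpr C Wgen) (f : V) : V :=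
  match e with
  | Scal c => fun z => c * f z
  | Gen g => wgen_op g f
  | Add u v => fun z => wop u f z + wop v f z
  | Mul u v => wop u (wop v f)
  end.

(* Formal adjoint on W: e^{-2 pi c p} and e^{2 pi d x} are formally
   self-adjoint for real c and d. *)
Fixpoint wadj (e : ncexpr C Wgen) : ncexpr C Wgen :=
  match e with
  | Scal c => Scal c^*
  | Gen g => Gen g
  | Add u v => Add (wadj u) (wadj v)
  | Mul u v => Mul (wadj v) (wadj u)
  end.

Variable b : R.
Local Notation ExprP c := (Gen (ExpP c)).
Local Notation ExprX d := (Gen (ExpX d)).

Definition rep_pi (g : Bgen) : ncexpr C Wgen :=
  match g with
  | GX => ExprP b
  | GY => ExprX b
  | GXt => ExprP b^-1
  | GYt => ExprX b^-1
  end.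

Definition rep_rdual (g : Bgen) : ncexpr C Wgen :=
  match g with
  | GX => ExprP b
  | GY => Mul (Scal (-1)) (Mul (ExprP b) (ExprX b))
  | GXt => ExprP b^-1
  | GYt => Mul (Scal (-1)) (Mul (ExprP b^-1) (ExprX b^-1))
  end.

Definition rep_ldual (g : Bgen) : ncexpr C Wgen :=
  match g with
  | GX => ExprP b
  | GY => Mul (Scal (-1)) (Mul (ExprX b) (ExprP b))
  | GXt => ExprP b^-1
  | GYt => Mul (Scal (-1)) (Mul (ExprX b^-1) (ExprP b^-1))
  end.

(* The operator of u in the representation sending the generators to the
   operators rho, and its formal adjoint on W. For the three representations
   above they do not depend on the representative of u: see
   rep_op_cls and rep_adj_cls. *)
Definition rep_op (rho : Bgen -> ncexpr C Wgen) (u : calB b) : V -> V :=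
  wop (subst rho (repr u)).
Definition rep_adj (rho : Bgen -> ncexpr C Wgen) (u : calB b) : V -> V :=
  wop (wadj (subst rho (repr u))).

End Weyl.

Section WellDefined.
Variable R : realType.
Local Notation C := R[i].
Local Notation V := (C -> C).

Lemma cexpD (x y : C) : cexp (x + y) = cexp x * cexp y.
Proof.
case: x => x1 x2; case: y => y1 y2.
rewrite /cexp /= expRD cosD sinD.
apply/eqP; rewrite eq_complex /=; apply/andP; split; apply/eqP; ring.
Qed.

Lemma cexp2pii : cexp (((2 * pi) *i) : C) = 1.
Proof.
rewrite /cexp /= expR0 mul1r mulr_natl cos2pi.
have -> : sin (pi *+ 2 : R) = 0 by rewrite mulr2n sinD sinpi mul0r mulr0 addr0.
by [].
Qed.

Lemma conj_phase2 (x : R) :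
  (cexp (x *i) ^+ 2)^* * cexp (x *i) ^+ 2 = 1 :> C.
Proof.
rewrite rmorphXn -exprMn; suff -> : (cexp (x *i))^* * cexp (x *i) = 1 :> C.
  by rewrite expr1n.
rewrite /cexp /= expR0 mul1r; apply/eqP; rewrite eq_complex /=.
apply/andP; split; apply/eqP; last by ring.
by rewrite -(cos2Dsin2 x); ring.
Qed.

Lemma wop_scal e (k : C) (f : V) :
  wop e (fun z => k * f z) = fun z => k * wop e f z.
Proof.
elim: e k f => [c|[c|d]|u IHu v IHv|u IHu v IHv] k f //=.
- by apply/funext => z; rewrite mulrCA.
- by apply/funext => z; rewrite mulrCA.
- by rewrite IHu IHv; apply/funext => z; rewrite mulrDr.
- by rewrite IHv IHu.
Qed.

Lemma wop_add e (f g : V) :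
  wop e (fun z => f z + g z) = fun z => wop e f z + wop e g z.
Proof.
elim: e f g => [c|[c|d]|u IHu v IHv|u IHu v IHv] f g //=.
- by apply/funext => z; rewrite mulrDr.
- by apply/funext => z; rewrite mulrDr.
- by rewrite IHu IHv; apply/funext => z; rewrite addrACA.
- by rewrite IHv IHu.
Qed.

Variable b : R.

Definition well_defined (rho : Bgen -> ncexpr C (Wgen R)) : Prop :=
  forall u v, Beq b u v -> forall f : V,
    wop (subst rho u) f = wop (subst rho v) f /\
    wop (wadj (subst rho u)) f = wop (wadj (subst rho v)) f.

Lemma rep_op_cls rho u : well_defined rho ->
  rep_op rho (cls b u) = wop (subst rho u).
Proof.
by move=> wd; apply/funext => f; have [] := wd _ _ (repr_cls b u) f.
Qed.

Lemma rep_adj_cls rho u : well_defined rho ->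
  rep_adj rho (cls b u) = wop (wadj (subst rho u)).
Proof.
by move=> wd; apply/funext => f; have [] := wd _ _ (repr_cls b u) f.
Qed.

Lemma rep_opM rho (u v : calB b) (f : V) : well_defined rho ->
  rep_op rho (u * v) f = rep_op rho u (rep_op rho v f).
Proof. by move=> wd; rewrite [u * v]/(cls _ _) rep_op_cls. Qed.

Lemma rep_opD rho (u v : calB b) (f : V) : well_defined rho ->
  rep_op rho (u + v) f = fun z => rep_op rho u f z + rep_op rho v f z.
Proof. by move=> wd; rewrite [u + v]/(cls _ _) rep_op_cls. Qed.

Lemma rep_opZ rho (c : C) (u : calB b) (f : V) : well_defined rho ->
  rep_op rho (c *: u) f = fun z => c * rep_op rho u f z.
Proof. by move=> wd; rewrite [c *: u]/(cls _ _) rep_op_cls. Qed.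

Lemma rep_op1 rho (f : V) : well_defined rho -> rep_op rho (1 : calB b) f = f.
Proof.
move=> wd; rewrite [1 : calB b]/(cls _ _) rep_op_cls //=.
by apply/funext => z; rewrite mul1r.
Qed.

Lemma well_definedP rho :
  (forall u v, (u, v) \in [::
     (Mul (Gen GX) (Gen GY),
      Mul (Scal (qpar b ^+ 2)) (Mul (Gen GY) (Gen GX)));
     (Mul (Gen GXt) (Gen GYt),
      Mul (Scal (qtpar b ^+ 2)) (Mul (Gen GYt) (Gen GXt)));
     (Mul (Gen GX) (Gen GXt), Mul (Gen GXt) (Gen GX));
     (Mul (Gen GX) (Gen GYt), Mul (Gen GYt) (Gen GX));
     (Mul (Gen GY) (Gen GXt), Mul (Gen GXt) (Gen GY));
     (Mul (Gen GY) (Gen GYt), Mul (Gen GYt) (Gen GY))] -> forall f : V,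
    wop (subst rho u) f = wop (subst rho v) f /\
    wop (wadj (subst rho u)) f = wop (wadj (subst rho v)) f) ->
  well_defined rho.
Proof.
move=> rel u v; elim=> {u v}.
- by [].
- by move=> u v _ IH f; have [-> ->] := IH f.
- by move=> u v w _ IH1 _ IH2 f; have [-> ->] := IH1 f; exact: IH2.
- move=> u u' v v' _ IH1 _ IH2 f /=.
  by have [-> ->] := IH1 f; have [-> ->] := IH2 f.
- move=> u u' v v' _ IH1 _ IH2 f /=; split.
    by rewrite (IH2 f).1 (IH1 _).1.
  by rewrite (IH1 f).2 (IH2 _).2.
- by move=> u v w f /=; split; apply/funext => z; rewrite addrA.
- by move=> u v f /=; split; apply/funext => z; rewrite addrC.
- move=> u f /=; split; apply/funext => z; first by rewrite mul0r add0r.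
  by rewrite rmorph0 mul0r add0r.
- move=> u f /=; split; apply/funext => z.
    by rewrite mul0r mulN1r addNr.
  by rewrite wop_scal rmorph0 rmorphN1 mul0r mulN1r addNr.
- by [].
- move=> u f /=; split; first by apply/funext => z; rewrite mul1r.
  by rewrite wop_scal; apply/funext => z; rewrite rmorph1 mul1r.
- by move=> u v w f /=; split => //; rewrite wop_add.
- by move=> u v w f /=; split => //; rewrite wop_add.
- by move=> c d f /=; split; apply/funext => z; rewrite ?rmorphD mulrDl.
- move=> c d f /=; split; apply/funext => z; first by rewrite mulrA.
  by rewrite rmorphM mulrA [d^* * _]mulrC.
- by move=> c u f /=; rewrite !wop_scal.
all: by move=> f; apply: rel; rewrite !inE eqxx ?orbT.
Qed.

Local Notation S c := (@wgen_op R (ExpP c)).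
Local Notation M d := (@wgen_op R (ExpX d)).

Let sc (k : C) (f : V) : V := fun z => k * f z.

Let wopS c f : wop (Gen (ExpP c)) f = S c f. Proof. by []. Qed.
Let wopM d f : wop (Gen (ExpX d)) f = M d f. Proof. by []. Qed.
Let wopC k f : wop (Scal k) f = sc k f. Proof. by []. Qed.
Let wopMul u v f : wop (Mul u v) f = wop u (wop v f) :> V. Proof. by []. Qed.
Let S_sc c k f : S c (sc k f) = sc k (S c f). Proof. by []. Qed.
Let M_sc d k f : M d (sc k f) = sc k (M d f).
Proof. by apply/funext => z; rewrite /= /sc mulrCA. Qed.
Let sc_sc k l f : sc k (sc l f) = sc (k * l) f.
Proof. by apply/funext => z; rewrite /sc mulrA. Qed.
Let sc1 f : sc 1 f = f.
Proof. by apply/funext => z; rewrite /sc mul1r. Qed.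

Let SC f : S b^-1 (S b f) = S b (S b^-1 f).
Proof. by apply/funext => z /=; rewrite addrAC. Qed.
Let MC f : M b^-1 (M b f) = M b (M b^-1 f).
Proof. by apply/funext => z /=; rewrite mulrCA. Qed.

Let SM c d f : S c (M d f) = sc (cexp ((2 * pi * (c * d)) *i)) (M d (S c f)).
Proof.
apply/funext => z; rewrite /sc /= mulrA -cexpD; congr (cexp _ * _).
case: z => x y; apply/eqP; rewrite eq_complex /=.
by apply/andP; split; apply/eqP; ring.
Qed.

Hypothesis b_neq0 : b != 0.

Let SMbb f : S b (M b f) = sc (qpar b ^+ 2) (M b (S b f)).
Proof.
rewrite SM; congr (sc _ _); rewrite expr2 -cexpD; congr cexp.
by apply/eqP; rewrite eq_complex /=; apply/andP; split; apply/eqP; ring.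
Qed.
Let SMtt f : S b^-1 (M b^-1 f) = sc (qtpar b ^+ 2) (M b^-1 (S b^-1 f)).
Proof.
rewrite SM; congr (sc _ _); rewrite expr2 -cexpD; congr cexp.
by apply/eqP; rewrite eq_complex /=; apply/andP; split; apply/eqP; ring.
Qed.
Let SMbt f : S b (M b^-1 f) = M b^-1 (S b f).
Proof. by rewrite SM divff // mulr1 cexp2pii sc1. Qed.
Let SMtb f : S b^-1 (M b f) = M b (S b^-1 f).
Proof. by rewrite SM mulVf // mulr1 cexp2pii sc1. Qed.

Let conj_qpar : (qpar b ^+ 2)^* * qpar b ^+ 2 = 1.
Proof. exact: conj_phase2. Qed.
Let conj_qtpar : (qtpar b ^+ 2)^* * qtpar b ^+ 2 = 1.
Proof. exact: conj_phase2. Qed.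

Let wopE := (wopMul, wopS, wopM, wopC).
Let commE :=
  (S_sc, M_sc, sc_sc, SMbb, SMtt, SMbt, SMtb, SC, MC).
Let sc_eq k l f : k = l -> sc k f = sc l f. Proof. by move->. Qed.
Let sc_eqr k f : 1 = k -> f = sc k f. Proof. by move<-; rewrite sc1. Qed.
Let sc_eql k f : k = 1 -> sc k f = f. Proof. by move->; rewrite sc1. Qed.

Lemma rep_pi_wd : well_defined (rep_pi b).
Proof.
apply: well_definedP => u v; rewrite !inE.
do 5?[case/orP]; move=> /eqP[-> ->] f; cbn [subst rep_pi wadj];
  rewrite !wopE; split; rewrite ?commE ?rmorphN1 //;
  first [apply: sc_eq | apply: sc_eqr | apply: sc_eql];
  ring: conj_qpar conj_qtpar.
Qed.

Lemma rep_rdual_wd : well_defined (rep_rdual b).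
Proof.
apply: well_definedP => u v; rewrite !inE.
do 5?[case/orP]; move=> /eqP[-> ->] f; cbn [subst rep_rdual wadj];
  rewrite !wopE; split; rewrite ?commE ?rmorphN1 //;
  first [apply: sc_eq | apply: sc_eqr | apply: sc_eql];
  ring: conj_qpar conj_qtpar.
Qed.

Lemma rep_ldual_wd : well_defined (rep_ldual b).
Proof.
apply: well_definedP => u v; rewrite !inE.
do 5?[case/orP]; move=> /eqP[-> ->] f; cbn [subst rep_ldual wadj];
  rewrite !wopE; split; rewrite ?commE ?rmorphN1 //;
  first [apply: sc_eq | apply: sc_eqr | apply: sc_eql];
  ring: conj_qpar conj_qtpar.
Qed.

End WellDefined.

Section Representations.
Variable R : realType.
Local Notation C := R[i].
Local Notation mu := (@lebesgue_measure R).
Variable b : R.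

(* The Schwartz space of rho: f in L^2(R) such that w |-> (f, rho(u) w) is
   bounded on W for the L^2 norm, for every u in B. *)
Definition Schwartz (rho : Bgen -> ncexpr C (Wgen R)) : set (R -> C) :=
  [set f | L2 f /\
    forall u : calB b, exists M : R, forall w, W w ->
      Normc.normc (L2inner f (onR (rep_op rho u w))) <= M * L2norm (onR w)].

(* rho(u) f = g on the Schwartz space, by duality against W:
   (g, w) = (f, rho(u)^* w), with rho(u)^* the formal adjoint of rho(u).
   For rep_pi this is the star of B; rep_rdual and rep_ldual are not
   star-representations, each formal adjoint being given by the other one. *)
Definition acts (rho : Bgen -> ncexpr C (Wgen R)) (u : calB b)
    (f g : R -> C) : Prop :=
  L2 g /\ forall w, W w -> L2inner g (onR w) = L2inner f (onR (rep_adj rho u w)).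

(* a dense subspace of L^2(R) carrying a representation of B by the action of
   rho on its Schwartz space, and containing W, on which that action is the
   one given by the operators rep_op *)
Definition rep_domain (rho : Bgen -> ncexpr C (Wgen R)) (D : set (R -> C)) :
    Prop :=
  [/\ (forall w, W w -> D (onR w)) /\ D `<=` Schwartz rho,
      L2dense D,
      (forall (u : calB b) w, W w -> acts rho u (onR w) (onR (rep_op rho u w))),
      (forall (c : C) f g, D f -> D g -> D (fun x => c * f x + g x)) &
      forall (u : calB b) f, D f -> exists2 g, D g & acts rho u f g].

(* (int_op k f)(y) = \int k(x, y) f(x) dx *)
Definition int_op (k : R -> R -> C) (f : R -> C) : R -> C :=
  fun y => cint (fun x => k x y * f x).

Definition ae_eqL2 (f g : R -> C) : Prop := {ae mu, forall x, f x = g x}.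

(* The integral operator with kernel k converges absolutely on D1 and is an
   isomorphism from the representation rho1 on D1 to rho2 on D2. *)
Definition rep_iso (rho1 rho2 : Bgen -> ncexpr C (Wgen R))
    (D1 D2 : set (R -> C)) (k : R -> R -> C) : Prop :=
  [/\ (forall f, D1 f -> forall y, cintegrable (fun x => k x y * f x)) /\
      (forall f, D1 f -> D2 (int_op k f)),
      (forall (c : C) f g, D1 f -> D1 g ->
        ae_eqL2 (int_op k (fun x => c * f x + g x))
                (fun y => c * int_op k f y + int_op k g y)),
      (forall f g, D1 f -> D1 g ->
        ae_eqL2 (int_op k f) (int_op k g) -> ae_eqL2 f g) /\
      (forall g, D2 g -> exists2 f, D1 f & ae_eqL2 (int_op k f) g) &
      forall (u : calB b) f g, D1 f -> D1 g ->
        acts rho1 u f g -> acts rho2 u (int_op k f) (int_op k g)].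

Definition apar : R := (b + b^-1) / 2.

Definition kern_k (x y : R) : C :=
  cexp ((pi * (x - y) ^+ 2) *i + (2 * pi * apar * (x - y))%:C).

Definition kern_K (x y : R) : C :=
  cexp (- ((pi * (x - y) ^+ 2) *i) - (2 * pi * apar * (x - y))%:C).

(* kernels of C', D', 'C and 'D, as functions of the integration variable and
   then of the output variable *)
Definition kern_C' : R -> R -> C := fun x y => kern_k x y.
Definition kern_D' : R -> R -> C := fun y x => kern_K x y.
Definition kern_lC : R -> R -> C := fun x z => kern_k z x.
Definition kern_lD : R -> R -> C := fun z x => kern_K z x.

End Representations.

(* Main.v *)
(** The common domain is the span of the functions exp(-al x^2/2 + be x) P(x)
    with Re al > 0. By contour deformation the integral of such a function is
    sqrt(2 pi / al) exp(be^2/(2 al)) (exp((1/(2 al)) d^2/ds^2) P)(be/al), so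
    convolution with exp(+-pi i t^2 + ka t) maps this span to itself by an
    explicit formula; in the composition of the + and - convolutions the
    constants multiply to 1 and the two heat operators have opposite times, so
    that they are inverse to each other. The same formula gives the invariance
    of these integrals under complex translations. This yields both the formal
    adjoints of the operators and the intertwining of exp(-2 pi b p), while for
    exp(2 pi b x) the intertwining is an identity between kernels, where
    2 a b = b^2 + 1 produces the sign exp(+-pi i) = -1.

    Density of W: u = exp(-A (x - c)^2) takes values in [0, 1], and polynomials
    in u without constant term, dominated by 4 u, converge to the indicator
    function of {u >= 1/2}, an arbitrary closed bounded interval. Density makes
    the action on the Schwartz space single-valued up to null sets. *)

Require Import Defs.
From HB Require Import structures.
From mathcomp Require Import all_boot all_order all_algebra.
From mathcomp Require Import complex ring lra.
From mathcomp Require Import all_classical all_reals all_analysis.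
From mathcomp Require Import measurable_realfun.
Import Order.TTheory GRing.Theory Num.Theory.
Import numFieldNormedType.Exports.
Import HBSimple HBNNSimple.

Set Implicit Arguments.
Unset Strict Implicit.
Unset Printing Implicit Defensive.

Local Open Scope classical_set_scope.
Local Open Scope complex_scope.
Local Open Scope ring_scope.

(** * Derivatives of complex-valued functions of a real variable *)

Section ComplexDerivative.
Variable R : realType.
Local Notation C := R[i].
Local Notation Re := complex.Re.
Local Notation Im := complex.Im.

(** The modulus of K(x,y) k(t,y) does not depend on y, so the double integral behind D'C' = id
    diverges absolutely and Fubini is of no help. Hence a domain on which each single integral
    converges absolutely and is known in closed form, so that the composition becomes algebra on
    parameters.

    In the coordinate 1/al, convolution is the translation by -1/(2 om) with om = pi i or -pi i.
    This number is imaginary: the half-plane Re al > 0 is preserved but the real half-line, which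
    defines W, is not.

    The value of a Gaussian integral contains a square root of al. It is carried as a parameter
    [lam] with Re lam > 0 and lam^2 = al, so that the branch is fixed and the prefactors of two
    successive convolutions can be multiplied without sign ambiguity. *)

Lemma Re_add (z w : C) : Re (z + w) = Re z + Re w.
Proof. by case: z w => ? ? []. Qed.
Lemma Im_add (z w : C) : Im (z + w) = Im z + Im w.
Proof. by case: z w => ? ? []. Qed.
Lemma Re_mul (z w : C) : Re (z * w) = Re z * Re w - Im z * Im w.
Proof. by case: z w => ? ? []. Qed.
Lemma Im_mul (z w : C) : Im (z * w) = Re z * Im w + Im z * Re w.
Proof. by case: z w => ? ? []. Qed.
Lemma cRe_conj (z : C) : Re z^* = Re z.
Proof. by case: z. Qed.
Lemma cIm_conj (z : C) : Im z^* = - Im z.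
Proof. by case: z. Qed.
Lemma complexP (z w : C) : Re z = Re w -> Im z = Im w -> z = w.
Proof. by case: z w => ? ? [] ? ? /= -> ->. Qed.

(** Componentwise, so that the theorems of real analysis apply to each part; [dh] is a function,
    although only its value at [t] matters, so that the rules below compose symbolically. *)
Definition cder (h dh : R -> C) (t : R) : Prop :=
  is_derive t (1 : R) (fun x => Re (h x)) (Re (dh t)) /\
  is_derive t (1 : R) (fun x => Im (h x)) (Im (dh t)).

Lemma eq_cder h dh dh' t : cder h dh t -> dh t = dh' t -> cder h dh' t.
Proof. by move=> + e; rewrite /cder e. Qed.

Lemma eq_fun_cder h g dh dg t : cder h dh t -> h =1 g -> dh t = dg t ->
  cder g dg t.
Proof. by move=> hd /funext <- e; exact: eq_cder hd e. Qed.

Lemma cder_cst (c : C) t : cder (fun=> c) (fun=> 0) t.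
Proof. by split; apply: is_derive_cst. Qed.

Lemma cder_real (f : R -> R) df t : is_derive t (1 : R) f (df t) ->
  cder (fun x => (f x)%:C) (fun x => (df x)%:C) t.
Proof. by move=> h; split => //=; apply: is_derive_cst. Qed.

Lemma cder_id t : cder (fun x => x%:C) (fun=> 1) t.
Proof. by split; [apply: is_derive_id|apply: is_derive_cst]. Qed.

Lemma cderD f df g dg t : cder f df t -> cder g dg t ->
  cder (fun x => f x + g x) (fun x => df x + dg x) t.
Proof.
move=> [f1 f2] [g1 g2]; split.
  by under eq_fun do rewrite Re_add; rewrite Re_add; apply: is_deriveD.
by under eq_fun do rewrite Im_add; rewrite Im_add; apply: is_deriveD.
Qed.

Lemma cderM f df g dg t : cder f df t -> cder g dg t ->
  cder (fun x => f x * g x) (fun x => df x * g x + f x * dg x) t.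
Proof.
move=> [f1 f2] [g1 g2]; split.
  under eq_fun do rewrite Re_mul.
  have H := is_deriveB (is_deriveM f1 g1) (is_deriveM f2 g2).
  apply: (is_derive_eq (H : is_derive t (1 : R) (fun x => _ - _) _)).
  by rewrite Re_add !Re_mul /GRing.scale /=; ring.
under eq_fun do rewrite Im_mul.
have H := is_deriveD (is_deriveM f1 g2) (is_deriveM f2 g1).
apply: (is_derive_eq (H : is_derive t (1 : R) (fun x => _ + _) _)).
by rewrite Im_add !Im_mul /GRing.scale /=; ring.
Qed.

Lemma cderZ c f df t : cder f df t ->
  cder (fun x => c * f x) (fun x => c * df x) t.
Proof.
move=> fd; apply: (eq_cder (cderM (cder_cst c t) fd)); by rewrite mul0r add0r.
Qed.

Lemma Re_cexp (z : C) : Re (cexp z) = expR (Re z) * cos (Im z).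
Proof. by rewrite /cexp Re_mul /= mul0r subr0. Qed.
Lemma Im_cexp (z : C) : Im (cexp z) = expR (Re z) * sin (Im z).
Proof. by rewrite /cexp Im_mul /= mul0r addr0. Qed.

Lemma cder_cexp f df t : cder f df t ->
  cder (fun x => cexp (f x)) (fun x => df x * cexp (f x)) t.
Proof.
move=> [f1 f2].
have e : is_derive t (1 : R) (fun x => expR (Re (f x)))
    (expR (Re (f t)) * Re (df t)).
  exact: is_derive1_comp.
have c : is_derive t (1 : R) (fun x => cos (Im (f x)))
    (- sin (Im (f t)) * Im (df t)).
  exact: is_derive1_comp.
have s : is_derive t (1 : R) (fun x => sin (Im (f x)))
    (cos (Im (f t)) * Im (df t)).
  exact: is_derive1_comp.
split.
  under eq_fun do rewrite Re_cexp.
  apply: (is_derive_eq (is_deriveM e c : is_derive t (1 : R)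
    (fun x => expR (Re (f x)) * cos (Im (f x))) _)).
  by rewrite Re_mul Re_cexp Im_cexp /GRing.scale /=; ring.
under eq_fun do rewrite Im_cexp.
apply: (is_derive_eq (is_deriveM e s : is_derive t (1 : R)
    (fun x => expR (Re (f x)) * sin (Im (f x))) _)).
by rewrite Im_mul Re_cexp Im_cexp /GRing.scale /=; ring.
Qed.

Lemma cder_horner (P : {poly C}) t :
  cder (fun x => P.[x%:C]) (fun x => P^`().[x%:C]) t.
Proof.
elim/poly_ind: P => [|P c IH].
  under eq_fun do rewrite horner0.
  by apply: eq_cder (cder_cst _ _) _; rewrite deriv0 horner0.
under eq_fun do rewrite hornerMXaddC.
apply: eq_cder.
  by apply: cderD (cder_cst c t); apply: cderM IH (cder_id t).
by rewrite derivD derivC derivM derivX !hornerE.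
Qed.

Lemma cder_continuous h dh : (forall t, cder h dh t) ->
  continuous (fun x => Re (h x)) /\ continuous (fun x => Im (h x)).
Proof.
move=> d; split => t; have [d1 d2] := d t;
  by apply/differentiable_continuous/derivable1_diffP.
Qed.

End ComplexDerivative.

(** * Gaussian bounds and complex integrals *)

Section GaussianDomination.
Variable R : realType.
Local Notation C := R[i].
Local Notation Re := complex.Re.
Local Notation Im := complex.Im.
Local Notation mu := (@lebesgue_measure R).

(** Submultiplicative like the modulus, free of square roots, and bounding both parts at once. *)
Definition norm1 (z : C) : R := `|Re z| + `|Im z|.

Lemma norm1_ge0 z : 0 <= norm1 z. Proof. exact: addr_ge0. Qed.

Lemma norm1D z w : norm1 (z + w) <= norm1 z + norm1 w.
Proof.
rewrite /norm1 Re_add Im_add.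
have := ler_normD (Re z) (Re w); have := ler_normD (Im z) (Im w); lra.
Qed.

Lemma norm1M z w : norm1 (z * w) <= norm1 z * norm1 w.
Proof.
rewrite /norm1 Re_mul Im_mul.
have := ler_normB (Re z * Re w) (Im z * Im w).
have := ler_normD (Re z * Im w) (Im z * Re w).
rewrite !normrM; nra.
Qed.

Lemma norm1_real (x : R) : norm1 x%:C = `|x|.
Proof. by rewrite /norm1 /= normr0 addr0. Qed.

Lemma norm1_cexp z : norm1 (cexp z) <= 2 * expR (Re z).
Proof.
rewrite /norm1 Re_cexp Im_cexp !normrM (ger0_norm (expR_ge0 _)).
have := cos_max (Im z); have := sin_max (Im z); have := expR_ge0 (Re z); nra.
Qed.

Lemma Re_le_n1 z : Re z <= norm1 z.
Proof. by rewrite (le_trans (ler_norm _))// lerDl. Qed.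

Lemma norm1N z : norm1 (- z) = norm1 z.
Proof. by case: z => a b; rewrite /norm1 /= !normrN. Qed.

(** An exponential bound is as good as a polynomial one, since [expR_quad_le] absorbs exp(r|x|) into
    a Gaussian; the Horner step uses |x| <= exp|x|. *)
Lemma norm1_horner (P : {poly C}) : exists K r : R, [/\ 0 <= K, 0 <= r &
  forall x : R, norm1 P.[x%:C] <= K * expR (r * `|x|)].
Proof.
elim/poly_ind: P => [|P c [K [r [K0 r0 H]]]].
  by exists 0, 0; split=> // x; rewrite horner0 mul0r norm1_real normr0.
exists (K + norm1 c), (r + 1); split; [exact: addr_ge0 K0 (norm1_ge0 _)|lra|move=> x].
rewrite hornerMXaddC (le_trans (norm1D _ _))// [leRHS]mulrDl; apply: lerD.
  rewrite (le_trans (norm1M _ _))// norm1_real [_ * `|x| in leRHS]mulrDl expRD mulrA mul1r.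
  apply: ler_pM => //; first exact: norm1_ge0.
  by rewrite (le_trans _ (expR_ge1Dx _))// lerDr.
rewrite -[leLHS]mulr1 ler_wpM2l ?norm1_ge0//.
by rewrite -expR0 ler_expR mulr_ge0// addr_ge0.
Qed.

(** By completing the square, half of the decay pays for the linear term; the constant s^2/p is not
    optimal. *)
Lemma expR_quad_le (p s x : R) : 0 < p ->
  expR (- p * x ^+ 2 + s * `|x|) <= expR (s ^+ 2 / p) * expR (- (p / 2) * x ^+ 2).
Proof.
move=> p0; rewrite -expRD ler_expR.
have -> : s ^+ 2 / p = p * (s / p) ^+ 2 by field; rewrite gt_eqF.
have -> : s * `|x| = p * ((s / p) * `|x|) by field; rewrite gt_eqF.
have := sqr_ge0 ((s / p) - `|x| / 2).
have := sqr_ge0 (s / p).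
have -> : x ^+ 2 = `|x| ^+ 2 by rewrite real_normK// num_real.
set y := `|x|; set u := s / p => h1 h2.
suff : 0 <= p * (u ^+ 2 - u * y + y ^+ 2 / 2) by lra.
apply: mulr_ge0; [exact: ltW|].
have -> : u ^+ 2 - u * y + y ^+ 2 / 2 = (u - y / 2) ^+ 2 + y ^+ 2 / 4 by field.
by rewrite addr_ge0// divr_ge0// sqr_ge0.
Qed.

Lemma integrable_gauss (p : R) : 0 < p ->
  mu.-integrable setT (EFin \o (fun x => expR (- p * x ^+ 2))).
Proof.
(* The normal density proportional to exp(-p x^2) has variance 1/(2p). *)
move=> p0; pose s : R := Num.sqrt (2 * p)^-1.
have s2 : s ^+ 2 *+ 2 = p^-1.
  rewrite sqr_sqrtr ?invr_ge0 ?mulr_ge0 ?ltW// -mulr_natl; field.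
  by rewrite gt_eqF.
have s0 : s != 0.
  by apply/eqP => s0; move/eqP: s2; rewrite s0 expr0n mul0rn eq_sym invr_eq0 gt_eqF.
have H := @integrableZl _ _ _ mu _ measurableT (normal_peak s)^-1 _ (integrable_normal_pdf 0 s).
apply: eq_integrable H => //= x _.
rewrite -EFinM; congr EFin; rewrite normal_pdfE// /normal_fun.
rewrite mulrA mulVf ?gt_eqF ?normal_peak_gt0// mul1r s2 subr0 invrK; congr expR; ring.
Qed.

Definition gbound (h : R -> C) : Prop :=
  exists M p : R, 0 < p /\ forall x, norm1 (h x) <= M * expR (- p * x ^+ 2).

Definition cmeas (h : R -> C) : Prop :=
  measurable_fun setT (fun x => Re (h x)) /\
  measurable_fun setT (fun x => Im (h x)).

(** Stable under sums, products and conjugation, and sufficient both for integrability and for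
    membership in L^2. *)
Definition gdom (h : R -> C) : Prop := cmeas h /\ gbound h.

Lemma cmeasD f g : cmeas f -> cmeas g -> cmeas (fun x => f x + g x).
Proof.
move=> [f1 f2] [g1 g2]; split.
  by under eq_fun do rewrite Re_add; apply: measurable_funD.
by under eq_fun do rewrite Im_add; apply: measurable_funD.
Qed.

Lemma cmeasM f g : cmeas f -> cmeas g -> cmeas (fun x => f x * g x).
Proof.
move=> [f1 f2] [g1 g2]; split.
  by under eq_fun do rewrite Re_mul; apply: measurable_funB; apply: measurable_funM.
by under eq_fun do rewrite Im_mul; apply: measurable_funD; apply: measurable_funM.
Qed.

Lemma cmeas_cst c : cmeas (fun=> c).
Proof. by split; apply: measurable_cst. Qed.

Lemma cmeas_conj f : cmeas f -> cmeas (fun x => (f x)^*).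
Proof.
move=> [f1 f2]; split.
  by under eq_fun do rewrite cRe_conj.
by under eq_fun do rewrite cIm_conj; exact: measurableT_comp.
Qed.

Lemma gboundD f g : gbound f -> gbound g -> gbound (fun x => f x + g x).
Proof.
move=> [M [p [p0 fM]]] [N [q [q0 gN]]].
exists (M + N), (Num.min p q); split; first by rewrite lt_min p0.
move=> x; rewrite (le_trans (norm1D _ _))// mulrDl.
have M0 : 0 <= M.
  by have := le_trans (norm1_ge0 _) (fM 0); rewrite pmulr_lge0 ?expR_gt0.
have N0 : 0 <= N.
  by have := le_trans (norm1_ge0 _) (gN 0); rewrite pmulr_lge0 ?expR_gt0.
have := sqr_ge0 x => x0.
apply: lerD; [apply: le_trans (fM x) _|apply: le_trans (gN x) _];
  by rewrite ler_wpM2l// ler_expR ler_wpM2r// lerN2 ge_min lexx ?orbT.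
Qed.

Lemma gboundM f g : gbound f -> gbound g -> gbound (fun x => f x * g x).
Proof.
move=> [M [p [p0 fM]]] [N [q [q0 gN]]].
exists (M * N), (p + q); split; first exact: addr_gt0.
move=> x; rewrite (le_trans (norm1M _ _))// opprD [(- p - q) * _]mulrDl expRD mulrACA.
by apply: ler_pM => //; apply: norm1_ge0.
Qed.

Lemma gboundZ c f : gbound f -> gbound (fun x => c * f x).
Proof.
move=> [M [p [p0 fM]]]; exists (norm1 c * M), p; split=> // x.
by rewrite (le_trans (norm1M _ _))// -mulrA ler_wpM2l// norm1_ge0.
Qed.

Lemma gbound_conj f : gbound f -> gbound (fun x => (f x)^*).
Proof.
move=> [M [p [p0 fM]]]; exists M, p; split=> // x.
by apply: le_trans (fM x); case: (f x) => a b; rewrite /norm1 /= normrN.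
Qed.

Lemma gdomD f g : gdom f -> gdom g -> gdom (fun x => f x + g x).
Proof. by move=> [? ?] [? ?]; split; [apply: cmeasD|apply: gboundD]. Qed.

Lemma gdomM f g : gdom f -> gdom g -> gdom (fun x => f x * g x).
Proof. by move=> [? ?] [? ?]; split; [apply: cmeasM|apply: gboundM]. Qed.

Lemma gdomZ c f : gdom f -> gdom (fun x => c * f x).
Proof.
move=> [? ?]; split; last exact: gboundZ.
by apply: cmeasM => //; exact: cmeas_cst.
Qed.

Lemma gdom_conj f : gdom f -> gdom (fun x => (f x)^*).
Proof. by move=> [? ?]; split; [apply: cmeas_conj|apply: gbound_conj]. Qed.

Lemma gdom0 : gdom (fun=> 0).
Proof.
split; first exact: cmeas_cst.
by exists 0, 1; split=> // x; rewrite mul0r norm1_real normr0.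
Qed.

Lemma gdom_integrable (f : R -> C) : gdom f -> cintegrable f.
Proof.
move=> [[f1 f2] [M [p [p0 fM]]]].
have gi : mu.-integrable setT (EFin \o (fun x => M * expR (- p * x ^+ 2))).
  exact: integrableZl (integrable_gauss p0).
have M0 : 0 <= M.
  by have := le_trans (norm1_ge0 _) (fM 0); rewrite pmulr_lge0 ?expR_gt0.
split; apply: le_integrable gi => //; try exact/measurable_EFinP.
  move=> x _ /=; rewrite lee_fin [leRHS]ger0_norm ?mulr_ge0 ?expR_ge0//.
  by apply: le_trans (fM x); rewrite lerDl.
move=> x _ /=; rewrite lee_fin [leRHS]ger0_norm ?mulr_ge0 ?expR_ge0//.
by apply: le_trans (fM x); rewrite lerDr.
Qed.

Lemma cintD (f g : R -> C) : cintegrable f -> cintegrable g ->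
  cint (fun x => f x + g x) = cint f + cint g.
Proof.
move=> [f1 f2] [g1 g2]; apply: complexP; rewrite ?Re_add ?Im_add /cint /=.
  by under eq_Rintegral do rewrite Re_add; rewrite RintegralD.
by under eq_Rintegral do rewrite Im_add; rewrite RintegralD.
Qed.

Lemma cintegrableZ c (f : R -> C) : cintegrable f -> cintegrable (fun x => c * f x).
Proof.
move=> [f1 f2]; split.
  apply: (@eq_integrable _ _ _ mu _ measurableT
    (fun x => (Re c)%:E * (Re (f x))%:E - (Im c)%:E * (Im (f x))%:E)%E).
    by move=> x _ /=; rewrite Re_mul EFinB !EFinM.
  by apply: integrableB => //; apply: integrableZl.
apply: (@eq_integrable _ _ _ mu _ measurableT
  (fun x => (Re c)%:E * (Im (f x))%:E + (Im c)%:E * (Re (f x))%:E)%E).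
  by move=> x _ /=; rewrite Im_mul EFinD !EFinM.
by apply: integrableD => //; apply: integrableZl.
Qed.

Lemma cintZ c (f : R -> C) : cintegrable f -> cint (fun x => c * f x) = c * cint f.
Proof.
move=> [f1 f2].
have Z (k : R) (g : R -> R) : mu.-integrable setT (EFin \o g) ->
    mu.-integrable setT (EFin \o (fun x => k * g x)).
  by move=> gi; apply: (@eq_integrable _ _ _ mu _ measurableT
    (fun x => k%:E * (g x)%:E)%E) => //; exact: integrableZl.
apply: complexP; rewrite ?Re_mul ?Im_mul /cint /=.
  under eq_Rintegral do rewrite Re_mul.
  by rewrite RintegralB ?RintegralZl//; apply: Z.
under eq_Rintegral do rewrite Im_mul.
by rewrite RintegralD ?RintegralZl//; apply: Z.
Qed.

Lemma cint0 : cint (fun=> 0 : C) = 0.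
Proof. by apply: complexP; rewrite /cint /= Rintegral_cst// mul0r. Qed.

End GaussianDomination.

(** * Integrals of derivatives, and dependence on a parameter *)

Section IntegralOfDerivative.
Variable R : realType.
Local Notation C := R[i].
Local Notation Re := complex.Re.
Local Notation Im := complex.Im.
Local Notation mu := (@lebesgue_measure R).

(** The fundamental theorem of calculus on growing intervals leaves boundary terms which the
    Gaussian bound on [F] sends to 0; dominated convergence passes to the whole line. *)
Lemma Rintegral_derive_eq0 (F f : R -> R) (M p : R) : 0 < p ->
  (forall t, is_derive t (1 : R) F (f t)) -> continuous f ->
  mu.-integrable setT (EFin \o f) ->
  (forall x, `|F x| <= M * expR (- p * x ^+ 2)) -> \int[mu]_x f x = 0.
Proof.
move=> p0 Ff cf fi FM.
have M0 : 0 <= M.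
  by have := le_trans (normr_ge0 _) (FM 0); rewrite pmulr_lge0 ?expR_gt0.
(* [n.+1] makes the interval nondegenerate already at n = 0. *)
pose h n : R -> \bar R := (EFin \o f) \_ `[- (n.+1)%:R, (n.+1)%:R].
have cF : continuous F.
  by move=> t; have := Ff t; move=> ?; apply/differentiable_continuous/derivable1_diffP.
have hE n : (\int[mu]_x h n x = (F n.+1%:R - F (- n.+1%:R))%:E)%E.
  rewrite -integral_mkcond (@continuous_FTC2 _ f F).
  - by rewrite EFinB.
  - by rewrite ltrNl (lt_trans _ (_ : (0 : R) < n.+1%:R))// oppr_lt0.
  - exact: continuous_subspaceT.
  - split; first by move=> t _; have := Ff t; case.
      exact: cvg_at_right_filter (cF _).
    exact: cvg_at_left_filter (cF _).
  - by move=> t _; rewrite derive1E; have := Ff t; case.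
have hf : (\int[mu]_x h n x)%E @[n --> \oo] --> (\int[mu]_x (f x)%:E)%E.
  apply: (@dominated_cvg _ _ _ mu setT measurableT h _ (fun x => `|f x|%:E)%E).
  - move=> n; apply/(measurable_restrictT _ _).1 => //.
    by apply: measurable_funTS; case/integrableP : fi.
  - move=> x _; apply: cvg_near_cst.
    near=> n; apply/eqP; rewrite /h patchE mem_set//= in_itv /= -ler_norml.
    rewrite ltW// (lt_trans _ (_ : n%:R < _)) ?ltr_nat//.
    by near: n; exact: nbhs_infty_gtr.
  - by [].
  - by have := integrable_abse fi.
  - move=> n x _; rewrite /h patchE; case: ifP => //=; rewrite ?normr0 lee_fin//.
have F0 : (F n.+1%:R - F (- n.+1%:R)) @[n --> \oo] --> (0 : R).
  have g0 : 2 * M * (expR (- p)) ^+ n @[n --> \oo] --> (0 : R).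
    rewrite -[X in _ --> X](mulr0 (2 * M)); apply: cvgMr.
    by apply: cvg_expr; rewrite ger0_norm ?expR_ge0// expR_lt1 oppr_lt0.
  apply: (@squeeze_cvgr _ _ _ _ (fun n => - (2 * M * expR (- p) ^+ n))
    (fun n => 2 * M * expR (- p) ^+ n)).
  - near=> n; rewrite -ler_norml (le_trans (ler_normB _ _))//.
    rewrite -mulrA mulr_natl mulr2n.
    have e : expR (- p * n.+1%:R ^+ 2) <= expR (- p) ^+ n.
      rewrite -expRM_natl ler_expR [leRHS]mulrC !mulNr lerN2 ler_pM2l// -natrX ler_nat.
      by rewrite -mulnn (leq_trans (leqnSn n))// leq_pmulr.
    apply: lerD; apply: le_trans (FM _) _; rewrite ?sqrrN ler_wpM2l//.
  - by rewrite -oppr0; exact: cvgN.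
  - exact: g0.
move: hf; under eq_fun do rewrite hE.
move=> hf; rewrite /Rintegral.
have H : (F n.+1%:R - F (- n.+1%:R))%:E @[n --> \oo] --> (0 : R)%:E.
  by apply: cvg_EFin; [exact: nearW|exact: F0].
by have := cvg_unique _ hf H => ->.
Unshelve. all: end_near. Qed.

(** Differentiation under the integral sign around each parameter value shows that the integral has
    derivative 0 everywhere. *)
Lemma Rintegral_param_cst (F dF : R -> R -> R) (M p s t : R) : 0 < p ->
  (forall t, mu.-integrable setT (EFin \o F t)) ->
  (forall t x, is_derive t (1 : R) (F ^~ x) (dF t x)) ->
  (forall t x, `|dF t x| <= M * expR (- p * x ^+ 2)) ->
  (forall t, \int[mu]_x dF t x = 0) ->
  \int[mu]_x F s x = \int[mu]_x F t x.
Proof.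
move=> p0 Fi FdF dFM dF0.
have M0 : 0 <= M.
  by have := le_trans (normr_ge0 _) (dFM 0 0); rewrite pmulr_lge0 ?expR_gt0.
apply: (@is_derive_0_is_cst _ (fun t => \int[mu]_x F t x)) => u.
have uI : `]u - 1, u + 1[%classic u by rewrite /= in_itv /=; lra.
have dd x y : derivable (F^~ y) x 1 by have := FdF x y; case.
have dE x y : partial1of2 F x y = dF x y.
  by rewrite partial1of2E; have := FdF x y; case.
have Gi : mu.-integrable setT (EFin \o (fun x => M * expR (- p * x ^+ 2))).
  exact: integrableZl (integrable_gauss p0).
have G0 y : 0 <= M * expR (- p * y ^+ 2) by rewrite mulr_ge0// expR_ge0.
have Gub x y : `]u - 1, u + 1[%classic x -> setT y ->
  `|partial1of2 F x y| <= M * expR (- p * y ^+ 2) by rewrite dE.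
have dF' x y : `]u - 1, u + 1[%classic x -> setT y -> derivable (F^~ y) x 1 by [].
have Fi' x : `]u - 1, u + 1[%classic x -> mu.-integrable setT (EFin \o F x) by [].
apply: DeriveDef.
  exact (derivable_under_integral measurableT uI Fi' dF' G0 Gi Gub).
rewrite -derive1E (differentiation_under_integral measurableT uI Fi' dF' G0 Gi Gub)//.
by under eq_Rintegral do rewrite dE.
Qed.

Lemma cint_derive_eq0 (F f : R -> C) : (forall t, cder F f t) -> gbound F ->
  gdom f -> continuous (fun x => Re (f x)) -> continuous (fun x => Im (f x)) ->
  cint f = 0.
Proof.
move=> Ff [M [p [p0 FM]]] fg fc1 fc2; have [fi1 fi2] := gdom_integrable fg.
apply: complexP => /=.
  apply: (@Rintegral_derive_eq0 (fun x => Re (F x)) _ M p) => //.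
    by move=> t; have [] := Ff t.
  by move=> x; apply: le_trans (FM x); rewrite lerDl.
apply: (@Rintegral_derive_eq0 (fun x => Im (F x)) _ M p) => //.
  by move=> t; have [] := Ff t.
by move=> x; apply: le_trans (FM x); rewrite lerDr.
Qed.

Lemma cint_param_cst (F dF : R -> R -> C) (M p s t : R) : 0 < p ->
  (forall t, cintegrable (F t)) ->
  (forall t x, cder (F ^~ x) (dF ^~ x) t) ->
  (forall t x, norm1 (dF t x) <= M * expR (- p * x ^+ 2)) ->
  (forall t, cint (dF t) = 0) ->
  cint (F s) = cint (F t).
Proof.
move=> p0 Fi FdF dFM dF0.
apply: complexP => /=.
  apply: (@Rintegral_param_cst (fun t x => Re (F t x)) (fun t x => Re (dF t x)) M p) => //.
  - by move=> u; have [] := Fi u.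
  - by move=> u x; have [] := FdF u x.
  - by move=> u x; apply: le_trans (dFM u x); rewrite lerDl.
  - by move=> u; have := congr1 (@complex.Re R) (dF0 u).
apply: (@Rintegral_param_cst (fun t x => Im (F t x)) (fun t x => Im (dF t x)) M p) => //.
- by move=> u; have [] := Fi u.
- by move=> u x; have [] := FdF u x.
- by move=> u x; apply: le_trans (dFM u x); rewrite lerDr.
- by move=> u; have := congr1 (@complex.Im R) (dF0 u).
Qed.

End IntegralOfDerivative.

(** * Complex Gaussians and contour deformation *)

Section ComplexGaussian.
Variable R : realType.
Local Notation C := R[i].
Local Notation Re := complex.Re.
Local Notation Im := complex.Im.
Local Notation mu := (@lebesgue_measure R).

Definition cgauss (al be : C) (P : {poly C}) (z : C) : C :=
  cexp (- al * z ^+ 2 / 2 + be * z) * P.[z].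

(** Differentiation conjugated by the Gaussian factor, hence an operator on polynomials; that its
    image integrates to 0 is integration by parts. *)
Definition dgauss (al be : C) (P : {poly C}) : {poly C} :=
  (be%:P - al *: 'X) * P + P^`().

Lemma cexp_real (x : R) : cexp x%:C = (expR x)%:C.
Proof.
apply: complexP; rewrite ?Re_cexp ?Im_cexp /= ?cos0 ?sin0 ?mulr1 //.
by rewrite mulr0.
Qed.

Lemma cint_real (f : R -> R) : cint (fun x => (f x)%:C) = (\int[mu]_x f x)%:C.
Proof. by rewrite /cint /= Rintegral_cst// mul0r. Qed.

Lemma horner_dgauss al be P z :
  (dgauss al be P).[z] = (be - al * z) * P.[z] + P^`().[z].
Proof. by rewrite /dgauss !hornerE. Qed.

Lemma cgauss_cder al be P t :
  cder (onR (cgauss al be P)) (onR (cgauss al be (dgauss al be P))) t.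
Proof.
have q : cder (fun x => - al * x%:C ^+ 2 / 2 + be * x%:C)
    (fun x => be - al * x%:C) t.
  have id2 := cderM (cder_id t) (cder_id t).
  apply: eq_fun_cder (cderD (cderZ (- al / 2) id2) (cderZ be (cder_id t))) _ _.
    by move=> x; ring.
  by field.
apply: eq_cder (cderM (cder_cexp q) (cder_horner P t)) _.
by rewrite /onR /cgauss horner_dgauss; ring.
Qed.

Lemma cgauss_continuous al be P :
  continuous (fun x => Re (onR (cgauss al be P) x)) /\
  continuous (fun x => Im (onR (cgauss al be P) x)).
Proof. by apply: cder_continuous; apply: cgauss_cder. Qed.

Lemma cgauss_cmeas al be P : cmeas (onR (cgauss al be P)).
Proof.
by have [c1 c2] := cgauss_continuous al be P; split;
  apply: continuous_measurable_fun.
Qed.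

Lemma cgauss_gdom al be P : 0 < Re al -> gdom (onR (cgauss al be P)).
Proof.
move=> al0; split; first exact: cgauss_cmeas.
have [K [r [K0 r0 PK]]] := norm1_horner P.
have a2 : 0 < Re al / 2 by rewrite divr_gt0.
pose s := `|Re be| + r.
exists (2 * K * expR (s ^+ 2 / (Re al / 2))), (Re al / 2 / 2); split.
  by rewrite divr_gt0.
move=> x; rewrite /onR /cgauss (le_trans (norm1M _ _))//.
apply: (@le_trans _ _ ((2 * expR (Re al / 2 * - x ^+ 2 + Re be * x)) * (K * expR (r * `|x|)))).
  apply: ler_pM (PK x) => //; rewrite ?norm1_ge0// (le_trans (norm1_cexp _))//.
  rewrite ler_pM2l// ler_expR le_eqVlt; apply/orP; left; apply/eqP.
  rewrite -[2 in LHS](_ : 2%:R%:C = _); last by rewrite rmorph_nat.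
  rewrite -rmorphXn -fmorphV Re_add !Re_mul /= !mulr0 !subr0.
  by case: al {al0 a2} => a1 a3 /=; ring.
apply: (@le_trans _ _ (2 * K * expR (- (Re al / 2) * x ^+ 2 + s * `|x|))).
  rewrite mulrACA -expRD ler_wpM2l ?mulr_ge0// ler_expR.
  have := ler_norm (Re be * x); rewrite normrM /s; lra.
by rewrite -[leRHS]mulrA ler_wpM2l ?mulr_ge0//; exact: expR_quad_le.
Qed.

Lemma cint_dgauss al be P : 0 < Re al ->
  cint (onR (cgauss al be (dgauss al be P))) = 0.
Proof.
move=> al0; have [c1 c2] := cgauss_continuous al be (dgauss al be P).
apply: (@cint_derive_eq0 _ (onR (cgauss al be P))) => //.
- exact: cgauss_cder.
- by have [] := cgauss_gdom be P al0.
- exact: cgauss_gdom.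
Qed.

Section AffineSubstitution.
Variables (lam m0 : C).
Hypothesis lam_gt0 : 0 < Re lam.
Hypothesis lam2_gt0 : 0 < Re (lam ^+ 2).

(* Contour deformation: [l t * x + m t] goes from [x] to [lam * x + m0], and the
   t-derivative of the integrand [F t] is the x-derivative of
   [(dl t * x + dm t) * cexp (ex t x)]. As [th] maps R onto [0, 1], the
   estimates are uniform in t. *)
Let th (t : R) : R := sin t ^+ 2.
Let dth (t : R) : R := 2 * sin t * cos t.
Let l t : C := 1 + (th t)%:C * (lam - 1).
Let m t : C := (th t)%:C * m0.
Let dl t : C := (dth t)%:C * (lam - 1).
Let dm t : C := (dth t)%:C * m0.

Let ex (t x : R) : C := - (l t * x%:C + m t) ^+ 2 / 2.
Let F (t x : R) : C := l t * cexp (ex t x).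
Let dF (t x : R) : C :=
  (dl t - l t * (l t * x%:C + m t) * (dl t * x%:C + dm t)) * cexp (ex t x).

Let th01 t : 0 <= th t <= 1.
Proof. by rewrite sqr_ge0 /= -(cos2Dsin2 t) lerDr sqr_ge0. Qed.

Let p := Num.min 1 (Re (lam ^+ 2)) / 2.
Let p_gt0 : 0 < p. Proof. by rewrite divr_gt0// lt_min ltr01. Qed.

(** With u = [th t], the real part is (1-u)^2 + u^2 Re(lam^2) + 2u(1-u) Re lam. The last term is
    nonnegative, and the first two are at least 2p((1-u)^2 + u^2) = p(1 + (2u-1)^2). Thus the
    integrand decays uniformly along the deformation. *)
Let Re_l2 t : p <= Re (l t ^+ 2).
Proof.
have /andP[t0 t1] := th01 t; rewrite /l.
have p1 : 2 * p <= 1 by rewrite mulrC divfK// ge_min lexx.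
have p2 : 2 * p <= Re (lam ^+ 2) by rewrite mulrC divfK// ge_min lexx orbT.
move: p_gt0 p1 p2 lam_gt0; case: lam => r s; rewrite !expr2 /= => p0 p1 p2 r0.
set u := th t in t0 t1 *.
have -> : (1 + (u * (r - 1) - 0 * (s - 0))) * (1 + (u * (r - 1) - 0 * (s - 0))) -
  (0 + (u * (s - 0) + 0 * (r - 1))) * (0 + (u * (s - 0) + 0 * (r - 1))) =
  (1 - u) ^+ 2 + u ^+ 2 * (r * r - s * s) + 2 * (u * (1 - u) * r) by ring.
have h1 : 0 <= u * (1 - u) * r.
  by apply: mulr_ge0; [apply: mulr_ge0; [|rewrite subr_ge0]|exact: ltW].
have h2 : u ^+ 2 * (2 * p) <= u ^+ 2 * (r * r - s * s) by rewrite ler_wpM2l// sqr_ge0.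
have h3 : (1 - u) ^+ 2 * (2 * p) <= (1 - u) ^+ 2.
  by rewrite -[leRHS]mulr1 ler_wpM2l// sqr_ge0.
have h4 : 0 <= p * (2 * u - 1) ^+ 2 by rewrite mulr_ge0 ?sqr_ge0// ltW.
nra.
Qed.

Let K := 1 + norm1 (lam - 1) + norm1 m0.
Let K_ge1 : 1 <= K.
Proof. by rewrite /K -addrA lerDl addr_ge0 ?norm1_ge0. Qed.

Let n1th t z : norm1 ((th t)%:C * z) <= norm1 z.
Proof.
have /andP[t0 t1] := th01 t.
rewrite (le_trans (norm1M _ _))// norm1_real ger0_norm//.
by rewrite ler_piMl// norm1_ge0.
Qed.

Let n1dth t z : norm1 ((dth t)%:C * z) <= 2 * norm1 z.
Proof.
rewrite (le_trans (norm1M _ _))// norm1_real ler_wpM2r ?norm1_ge0//.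
rewrite /dth !normrM; have := sin_max t; have := cos_max t.
rewrite (@ger0_norm _ 2)//; have := normr_ge0 (sin t); have := normr_ge0 (cos t); nra.
Qed.

Let n1l t : norm1 (l t) <= K.
Proof.
rewrite (le_trans (norm1D _ _))// (norm1_real 1) normr1 /K -addrA lerD2l.
by rewrite (le_trans (n1th _ _))// lerDl norm1_ge0.
Qed.
Let n1m t : norm1 (m t) <= K.
Proof. by rewrite (le_trans (n1th _ _))// /K lerDr addr_ge0// norm1_ge0. Qed.
Let n1dl t : norm1 (dl t) <= 2 * K.
Proof.
rewrite (le_trans (n1dth _ _))// ler_pM2l// /K.
have := norm1_ge0 m0; lra.
Qed.
Let n1dm t : norm1 (dm t) <= 2 * K.
Proof.
rewrite (le_trans (n1dth _ _))// ler_pM2l// /K.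
have := norm1_ge0 (lam - 1); lra.
Qed.

Let norm1_affine (a c : C) (k x : R) : norm1 a <= k -> norm1 c <= k ->
  norm1 (a * x%:C + c) <= k * expR `|x|.
Proof.
move=> ak ck; rewrite (le_trans (norm1D _ _))//.
have k0 := le_trans (norm1_ge0 _) ak.
apply: (@le_trans _ _ (k * (1 + `|x|))); last by rewrite ler_wpM2l// expR_ge1Dx.
rewrite mulrDr mulr1 addrC lerD// (le_trans (norm1M _ _))// norm1_real.
by rewrite ler_wpM2r.
Qed.

Let Re_ex t x : Re (ex t x) <= - (p / 2) * x ^+ 2 + K ^+ 2 * `|x| + K ^+ 2.
Proof.
have -> : Re (ex t x) = - Re (l t ^+ 2) / 2 * x ^+ 2 - Re (l t * m t) * x
     - Re (m t ^+ 2) / 2.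
  rewrite /ex -[2 in LHS](_ : 2%:R%:C = _); last by rewrite rmorph_nat.
  rewrite -fmorphV; case: (l t) (m t) => a1 a2 [c1 c2].
  by rewrite !expr2 /=; field.
have h1 := Re_l2 t.
have h2 : - Re (l t * m t) <= K ^+ 2 /\ Re (l t * m t) <= K ^+ 2.
  have h : norm1 (l t * m t) <= K ^+ 2.
    by rewrite (le_trans (norm1M _ _))// expr2 ler_pM ?norm1_ge0.
  split; last exact: le_trans (Re_le_n1 _) h.
  by apply: le_trans h; rewrite -norm1N; apply: le_trans (Re_le_n1 _); case: (_ * _).
have h3 : - Re (m t ^+ 2) <= K ^+ 2.
  apply: (@le_trans _ _ (norm1 (m t ^+ 2))).
    by rewrite -norm1N; apply: le_trans (Re_le_n1 _); case: (_ ^+ _).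
  by rewrite !expr2 (le_trans (norm1M _ _))// ler_pM ?norm1_ge0.
have x0 := sqr_ge0 x.
have h4 : p * x ^+ 2 <= Re (l t ^+ 2) * x ^+ 2 by rewrite ler_wpM2r.
have h5 : - Re (l t * m t) * x <= K ^+ 2 * `|x|.
  apply: (le_trans (ler_norm _)); rewrite normrM normrN ler_wpM2r//.
  by rewrite ler_norml; lra.
have := sqr_ge0 K; lra.
Qed.

(** The factors affine in x cost at most exp(2|x|), by 1 + |x| <= exp|x|. Together with the K^2 |x|
    of [Re_ex] this makes the linear term (K^2 + 2)|x|, which [expR_quad_le] removes. *)
Let dF_bound : exists M q : R, 0 < q /\
  forall t x, norm1 (dF t x) <= M * expR (- q * x ^+ 2).
Proof.
exists ((2 * K + 2 * K ^+ 3) * (2 * expR (K ^+ 2)) *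
  expR ((K ^+ 2 + 2) ^+ 2 / (p / 2))), (p / 2 / 2).
split; first by apply: divr_gt0 => //; apply: divr_gt0.
move=> t x; rewrite /dF (le_trans (norm1M _ _))//.
have p2 : 0 < p / 2 by apply: divr_gt0.
have K0 : 0 <= K by apply: le_trans K_ge1.
have e1 : 1 <= expR `|x| by rewrite -expR0 ler_expR.
have e2 : expR (2 * `|x|) = expR `|x| * expR `|x| by rewrite -expRD -mulr2n mulr_natl.
have b1 : norm1 (dl t - l t * (l t * x%:C + m t) * (dl t * x%:C + dm t)) <=
   (2 * K + 2 * K ^+ 3) * expR (2 * `|x|).
  rewrite (le_trans (norm1D _ _))// norm1N [leRHS]mulrDl; apply: lerD.
    rewrite (le_trans (n1dl t))// ler_peMr ?mulr_ge0//.
    by rewrite -expR0 ler_expR mulr_ge0.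
  rewrite e2 (_ : 2 * K ^+ 3 * _ = K * (K * expR `|x|) * (2 * K * expR `|x|)); last by ring.
  rewrite (le_trans (norm1M _ _))// ler_pM ?norm1_ge0//; last exact: norm1_affine.
  by rewrite (le_trans (norm1M _ _))// ler_pM ?norm1_ge0//; exact: norm1_affine.
have b2 : norm1 (cexp (ex t x)) <= 2 * (expR (K ^+ 2) * expR (- (p / 2) * x ^+ 2 + K ^+ 2 * `|x|)).
  by rewrite (le_trans (norm1_cexp _))// ler_pM2l// -expRD ler_expR addrC.
apply: le_trans (ler_pM (norm1_ge0 _) (norm1_ge0 _) b1 b2) _.
have b3 := expR_quad_le (K ^+ 2 + 2) x p2.
have -> : (2 * K + 2 * K ^+ 3) * expR (2 * `|x|) *
  (2 * (expR (K ^+ 2) * expR (- (p / 2) * x ^+ 2 + K ^+ 2 * `|x|))) =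
  (2 * K + 2 * K ^+ 3) * (2 * expR (K ^+ 2)) *
   expR (- (p / 2) * x ^+ 2 + (K ^+ 2 + 2) * `|x|).
  rewrite [(K ^+ 2 + 2) * _]mulrDl addrA [in RHS]expRD; ring.
rewrite -[leRHS]mulrA ler_wpM2l// mulr_ge0//.
by rewrite addr_ge0// mulr_ge0// exprn_ge0.
Qed.

Let cexp_ex t x P : cexp (ex t x) * P.[x%:C] =
  cexp (- m t ^+ 2 / 2) * onR (cgauss (l t ^+ 2) (- (l t * m t)) P) x.
Proof.
by rewrite /onR /cgauss mulrA -cexpD; congr (cexp _ * _); rewrite /ex; field.
Qed.

Let Re_l2_gt0 t : 0 < Re (l t ^+ 2).
Proof. exact: lt_le_trans (Re_l2 t). Qed.

Lemma cint_gauss_affine :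
  lam * cint (fun x => cexp (- (lam * x%:C + m0) ^+ 2 / 2)) =
  (Num.sqrt (pi *+ 2))%:C.
Proof.
have [M [q [q0 dFM]]] := dF_bound.
have FE t : F t = fun x => (l t * cexp (- m t ^+ 2 / 2)) *
    onR (cgauss (l t ^+ 2) (- (l t * m t)) 1) x.
  by apply/funext => x; rewrite -mulrA -cexp_ex hornerC mulr1.
have Fi t : cintegrable (F t).
  rewrite FE; apply: cintegrableZ; apply: gdom_integrable.
  exact: cgauss_gdom.
have dthE t : is_derive t (1 : R) th (dth t).
  have h : is_derive t (1 : R) th _ := is_deriveM (is_derive_sin t) (is_derive_sin t).
  apply: (is_derive_eq h).
  by rewrite /GRing.scale /= /dth; ring.
have lE t : cder l dl t.
  apply: eq_cder (cderD (cder_cst 1 t) (cderM (cder_real (dthE t)) (cder_cst (lam - 1) t))) _.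
  by rewrite mulr0 addr0 add0r.
have mE t : cder m dm t.
  apply: eq_cder (cderM (cder_real (dthE t)) (cder_cst m0 t)) _.
  by rewrite mulr0 addr0.
have exE t x : cder (ex^~ x) (fun t => - (l t * x%:C + m t) * (dl t * x%:C + dm t)) t.
  have a : cder (fun t => l t * x%:C + m t) (fun t => dl t * x%:C + dm t) t.
    apply: eq_cder (cderD (cderM (lE t) (cder_cst x%:C t)) (mE t)) _.
    by rewrite mulr0 addr0.
  by apply: eq_fun_cder (cderZ (- 1 / 2) (cderM a a)) _ _ => [u|]; rewrite /ex; field.
have FdF t x : cder (F^~ x) (dF^~ x) t.
  by apply: eq_cder (cderM (lE t) (cder_cexp (exE t x))) _; rewrite /dF; ring.
have dF0 t : cint (dF t) = 0.
  have -> : dF t = fun x => cexp (- m t ^+ 2 / 2) * onR (cgauss (l t ^+ 2) (- (l t * m t))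
      (dgauss (l t ^+ 2) (- (l t * m t)) (dl t *: 'X + (dm t)%:P))) x.
    apply/funext => x; rewrite -cexp_ex /dF mulrC; congr (_ * _).
    move: (dl t) (dm t) (l t) (m t) => u1 u2 u3 u4.
    rewrite horner_dgauss derivD derivC derivZ derivX.
    by rewrite !(hornerD, hornerZ, hornerX, hornerC); ring.
  rewrite cintZ ?cint_dgauss ?mulr0//.
  by apply: gdom_integrable; apply: cgauss_gdom.
(* sin^2 is 1 at pi/2 and 0 at 0: the deformed integral is compared with that of the standard normal
   density. *)
have := @cint_param_cst R F dF M q (pi / 2) 0 q0 Fi FdF dFM dF0.
rewrite /F /ex /l /m /th sin_pihalf sin0 expr1n expr0n /= !mul1r !mul0r addr0.
rewrite [1 + _]addrC subrK cintZ; last first.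
  have := Fi (pi / 2); rewrite /F => /(cintegrableZ (lam^-1)).
  rewrite /ex /l /m /th sin_pihalf expr1n !mul1r [1 + _]addrC subrK.
  have lam0 : lam != 0 by apply/eqP => l0; move: lam_gt0; rewrite l0 ltxx.
  by congr cintegrable; apply/funext => x; rewrite mulKf.
move=> ->.
rewrite (_ : (fun x : R => _) =
  fun x : R => (Num.sqrt (pi *+ 2) * normal_pdf 0 1 x)%:C); last first.
  apply/funext => x; rewrite mul1r addr0 mul1r.
  rewrite (_ : - x%:C ^+ 2 / 2 = (- x ^+ 2 / 2)%:C); last first.
    by rewrite rmorphM fmorphV rmorphN rmorphXn rmorph_nat.
  rewrite cexp_real normal_pdfE ?oner_eq0// /normal_peak expr1n mul1r mulrA.
  rewrite divff ?mul1r; last by rewrite gt_eqF// sqrtr_gt0 mulrn_wgt0// pi_gt0.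
  by rewrite /normal_fun subr0 expr1n.
rewrite cint_real RintegralZl//; last exact: integrable_normal_pdf.
by rewrite /Rintegral integral_normal_pdf mulr1.
Qed.

End AffineSubstitution.

End ComplexGaussian.

(** * The heat operator on polynomials *)

Section HeatOperator.
Variable K : comNzRingType.

(** Multiplication by X conjugated by the heat operator: exp((g/2) D^2) X exp(-(g/2) D^2) = X + g
    D. *)
Definition heat_step (g : K) (Q : {poly K}) : {poly K} := Q * 'X + g *: Q^`().

(* [heat g] is exp((g/2) d^2/dX^2), the expectation of [P] shifted by a
   centered Gaussian variable of variance [g], computed by Horner's scheme. *)
Definition heat (g : K) (P : {poly K}) : {poly K} :=
  foldr (fun c Q => heat_step g Q + c%:P) 0 P.

Lemma heat0 g : heat g 0 = 0.
Proof. by rewrite /heat polyseq0. Qed.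

Lemma heat_step0 g : heat_step g 0 = 0.
Proof. by rewrite /heat_step mul0r deriv0 scaler0 addr0. Qed.

Lemma heatMXaddC g P c : heat g (P * 'X + c%:P) = heat_step g (heat g P) + c%:P.
Proof.
rewrite -cons_poly_def /heat polyseq_cons; case: ifP => //= /negbFE.
(* For P = 0 the coefficient list is that of the constant c, empty when c = 0. *)
rewrite nil_poly => /eqP ->; rewrite polyseq0 /= heat_step0 add0r polyseqC.
by case: eqP => [->|] //=; rewrite heat_step0 add0r.
Qed.

Lemma heat_stepD g P Q : heat_step g (P + Q) = heat_step g P + heat_step g Q.
Proof. by rewrite /heat_step derivD mulrDl scalerDr addrACA. Qed.

Lemma heat_stepZ g c P : heat_step g (c *: P) = c *: heat_step g P.
Proof. by rewrite /heat_step derivZ scalerDr -scalerAl !scalerA [g * c]mulrC. Qed.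

Lemma heatD g P Q : heat g (P + Q) = heat g P + heat g Q.
Proof.
elim/poly_ind: P Q => [|P c IH] Q; first by rewrite heat0 !add0r.
elim/poly_ind: Q => [|Q d _]; first by rewrite heat0 !addr0.
rewrite addrACA -mulrDl -polyCD !heatMXaddC IH heat_stepD polyCD.
by rewrite addrACA.
Qed.

Lemma heatZ g c P : heat g (c *: P) = c *: heat g P.
Proof.
elim/poly_ind: P => [|P d IH]; first by rewrite heat0 !scaler0 heat0.
rewrite scalerDr scalerAl -[c *: d%:P]mul_polyC -polyCM !heatMXaddC IH.
by rewrite heat_stepZ [RHS]scalerDr -[c *: d%:P]mul_polyC polyCM.
Qed.

Lemma heatMX g P : heat g (P * 'X) = heat_step g (heat g P).
Proof. by have := heatMXaddC g P 0; rewrite !addr0. Qed.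

Lemma heatC g c : heat g c%:P = c%:P.
Proof. by have := heatMXaddC g 0 c; rewrite mul0r heat0 heat_step0 !add0r. Qed.

Lemma heat_deriv g P : heat g P^`() = (heat g P)^`().
Proof.
elim/poly_ind: P => [|P c IH]; first by rewrite deriv0 heat0 deriv0.
rewrite derivD derivC addr0 derivM derivX mulr1 heatD heatMX IH.
rewrite heatMXaddC derivD derivC addr0 /heat_step derivD derivM derivX mulr1.
by rewrite derivZ; ring.
Qed.

Lemma heat_heat g g' P : heat g' (heat g P) = heat (g + g') P.
Proof.
elim/poly_ind: P => [|P c IH]; first by rewrite !heat0.
rewrite !heatMXaddC heatD heatC; congr (_ + _).
rewrite {1}/heat_step heatD heatMX heatZ heat_deriv IH /heat_step.
by rewrite scalerDl addrAC addrA.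
Qed.

Lemma heat_id P : heat 0 P = P.
Proof.
elim/poly_ind: P => [|P c IH]; first by rewrite heat0.
by rewrite heatMXaddC IH /heat_step scale0r addr0.
Qed.

(** Two derivatives of P o sg bring out the factor s1^2, so the substitution rescales the heat time
    by it. *)
Lemma heat_comp_affine g (s1 s0 : K) P (sg := s1 *: 'X + s0%:P) :
  heat g (P \Po sg) = heat (g * s1 ^+ 2) P \Po sg.
Proof.
elim/poly_ind: P => [|P c IH]; first by rewrite comp_poly0 !heat0 comp_poly0.
rewrite comp_polyD comp_polyC heatD heatC heatMXaddC [RHS]comp_polyD comp_polyC.
congr (_ + _); rewrite [in RHS]/heat_step comp_polyD comp_polyZ !comp_polyM !comp_polyX.
set Q := P \Po sg in IH *.
rewrite {1}/sg mulrDr -scalerAr heatD heatZ heatMX /heat_step.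
rewrite [Q * _]mulrC mul_polyC heatZ IH deriv_comp.
rewrite {4}/sg derivD derivC derivZ derivX addr0.
set U := heat _ P.
rewrite -/sg; move: (U \Po sg) (U^`() \Po sg) => V V'.
rewrite /sg -!mul_polyC !expr2 !polyCM; ring.
Qed.

End HeatOperator.

(** * Moments of complex Gaussians *)

Section GaussianIntegral.
Variable R : realType.
Local Notation C := R[i].
Local Notation Re := complex.Re.
Local Notation Im := complex.Im.

(** With al = lam^2, integration by parts gives I(QX) = (be/al) I(Q) + (1/al) I(Q'), which is the
    recursion of [heat] evaluated at be/al. As Q' enters, the induction is on a bound for the
    size. *)
Lemma cint_cgauss (lam be : C) P : 0 < Re lam -> 0 < Re (lam ^+ 2) ->
  cint (onR (cgauss (lam ^+ 2) be P)) =
  (Num.sqrt (pi *+ 2))%:C / lam * cexp (be ^+ 2 / (2 * lam ^+ 2)) *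
  (heat (lam ^- 2) P).[be / lam ^+ 2].
Proof.
move=> l0 l20; have lam0 : lam != 0.
  by apply/eqP => e; move: l0; rewrite e ltxx.
set k := _ * cexp _.
have int Q : cintegrable (onR (cgauss (lam ^+ 2) be Q)).
  by apply: gdom_integrable; apply: cgauss_gdom.
have gD Q1 Q2 : cint (onR (cgauss (lam ^+ 2) be (Q1 + Q2))) =
    cint (onR (cgauss (lam ^+ 2) be Q1)) + cint (onR (cgauss (lam ^+ 2) be Q2)).
  rewrite -cintD//; congr cint; apply/funext => x.
  by rewrite /onR /cgauss hornerD mulrDr.
have gZ c Q : cint (onR (cgauss (lam ^+ 2) be (c *: Q))) =
    c * cint (onR (cgauss (lam ^+ 2) be Q)).
  rewrite -cintZ//; congr cint; apply/funext => x.
  by rewrite /onR /cgauss hornerZ mulrCA.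
have g1 : cint (onR (cgauss (lam ^+ 2) be 1)) = k.
  have -> : onR (cgauss (lam ^+ 2) be 1) = fun x =>
      cexp (be ^+ 2 / (2 * lam ^+ 2)) * cexp (- (lam * x%:C + (- (be / lam))) ^+ 2 / 2).
    apply/funext => x; rewrite /onR /cgauss hornerC mulr1 -cexpD; congr cexp.
    by field; rewrite lam0.
  rewrite /k -(cint_gauss_affine (- (be / lam)) l0 l20) cintZ.
    by rewrite [lam * _]mulrC mulfK// mulrC.
  have := int 1; move=> /(cintegrableZ (cexp (- (be ^+ 2 / (2 * lam ^+ 2))))).
  congr cintegrable; apply/funext => x.
  rewrite /onR /cgauss hornerC mulr1 -cexpD; congr cexp.
  by field; rewrite lam0.
have gX Q : cint (onR (cgauss (lam ^+ 2) be (Q * 'X))) =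
    be / lam ^+ 2 * cint (onR (cgauss (lam ^+ 2) be Q)) +
    lam ^- 2 * cint (onR (cgauss (lam ^+ 2) be Q^`())).
  have := cint_dgauss be Q l20.
  rewrite /dgauss mulrBl mul_polyC -scalerAl ['X * _]mulrC !gD -scaleNr !gZ.
  move: (cint (onR (cgauss _ be (Q * 'X)))) (cint (onR (cgauss _ be Q)))
    (cint (onR (cgauss _ be Q^`()))) => u v w e.
  apply: (@mulfI _ (lam ^+ 2)); first by rewrite expf_neq0.
  by rewrite -[LHS]addr0 -e; field; rewrite lam0.
suff H : forall n (Q : {poly C}), (size Q <= n)%N -> cint (onR (cgauss (lam ^+ 2) be Q)) =
    k * (heat (lam ^- 2) Q).[be / lam ^+ 2] by exact: (H (size P)).
elim=> [|n IH] Q.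
  rewrite leqn0 size_poly_eq0 => /eqP ->; rewrite heat0 horner0 mulr0.
  by rewrite -(scale0r 0) gZ mul0r.
elim/poly_ind: Q => [|Q c _] sQ.
  by rewrite heat0 horner0 mulr0 -(scale0r 0) gZ mul0r.
have sQ' : (size Q <= n)%N.
  by move: sQ; rewrite size_MXaddC; case: ifP => [/andP[/eqP ->]|]; rewrite ?size_poly0.
have sdQ : (size Q^`() <= n)%N.
  by apply: leq_trans sQ'; apply: leq_trans (size_poly _ _) (leq_pred _).
rewrite gD gX (IH _ sQ') (IH _ sdQ) heat_deriv heatMXaddC hornerD hornerC /heat_step.
rewrite hornerD hornerMX hornerZ -[c%:P]mulr1 mul_polyC gZ g1.
by ring.
Qed.

(** One of the two opposite roots works: if their real part were 0, the square would have
    nonpositive real part. *)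
Lemma exists_sqrt (al : C) : 0 < Re al -> exists2 lam, 0 < Re lam & lam ^+ 2 = al.
Proof.
move=> al0; have := sqr_sqrtc al; set l := sqrtc al => e.
have [l0|l0|l0] := ltgtP 0 (Re l); first by exists l.
  by exists (- l); [case: (l) l0 => ? ? /=; rewrite oppr_gt0|rewrite sqrrN].
move: al0; rewrite -e; case: (l) l0 => ? y /= <-.
by rewrite expr2 /= mulr0 add0r oppr_gt0 ltNge -expr2 sqr_ge0.
Qed.

End GaussianIntegral.

(** * The Gaussian space and formal adjoints *)

Section GaussianSpace.
Variable R : realType.
Local Notation C := R[i].
Local Notation Re := complex.Re.
Local Notation Im := complex.Im.

(* The span of the [cgauss al be P] with [al] in [S]; unlike [W], which is the
   case of positive real [al], the space [CW] is preserved by convolution with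
   the imaginary Gaussian kernels. *)
Inductive gspan (S : set C) : (C -> C) -> Prop :=
| gspan0 : gspan S (fun=> 0)
| gspan_cons al be P f : S al -> gspan S f ->
    gspan S (fun z => cgauss al be P z + f z).

Definition half_plane : set C := fun al => 0 < Re al.
Definition half_line : set C := fun al => exists2 A, 0 < A & A%:C = al.

Notation CW := (gspan half_plane).

Lemma gspan_cgauss (S : set C) al be P : S al -> gspan S (cgauss al be P).
Proof.
move=> al0; rewrite (_ : cgauss _ _ _ = fun z => cgauss al be P z + 0).
  by apply: gspan_cons => //; exact: gspan0.
by apply/funext => z; rewrite addr0.
Qed.

Lemma gspan_add (S : set C) f g :
  gspan S f -> gspan S g -> gspan S (fun z => f z + g z).
Proof.
elim=> [|al be P {}f al0 _ IH] gW.
  by rewrite (_ : (fun _ => _) = g)//; apply/funext => z; rewrite add0r.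
rewrite (_ : (fun _ => _) = fun z => cgauss al be P z + (f z + g z)).
  exact: gspan_cons (IH gW).
by apply/funext => z; rewrite addrA.
Qed.

(** Additivity rather than linearity of [T], so that the conjugate-linear [sharp] is covered;
    scalars are absorbed by the polynomial factors. *)
Lemma gspan_map (S S' : set C) (T : (C -> C) -> C -> C) :
  T (fun=> 0) = (fun=> 0) ->
  (forall f g, gspan S f -> gspan S g ->
    T (fun z => f z + g z) = fun z => T f z + T g z) ->
  (forall al be P, S al -> gspan S' (T (cgauss al be P))) ->
  forall f, gspan S f -> gspan S' (T f).
Proof.
move=> T0 TD TG f; elim=> [|al be P {}f al0 fW IH]; first by rewrite T0; exact: gspan0.
rewrite TD//; last exact: gspan_cgauss.
by apply: gspan_add IH; exact: TG.
Qed.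

Lemma cgaussZ c (al be : C) P z :
  c * cgauss al be P z = cgauss al be (c *: P) z.
Proof. by rewrite /cgauss hornerZ mulrCA. Qed.

Lemma cgauss_shift (al be : C) P (w z : C) : cgauss al be P (z + w) =
  cgauss al (be - al * w) (cexp (- al * w ^+ 2 / 2 + be * w) *: (P \Po ('X + w%:P))) z.
Proof.
rewrite -cgaussZ /cgauss mulrA -cexpD horner_comp hornerD hornerX hornerC.
by congr (cexp _ * _); field.
Qed.

Lemma cgauss_expM (al be : C) P (d z : C) :
  cexp (d * z) * cgauss al be P z = cgauss al (be + d) P z.
Proof. by rewrite /cgauss mulrA -cexpD; congr (cexp _ * _); ring. Qed.

Lemma cgaussM (al be al' be' : C) P P' z :
  cgauss al be P z * cgauss al' be' P' z = cgauss (al + al') (be + be') (P * P') z.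
Proof. by rewrite /cgauss mulrACA -cexpD hornerM; congr (cexp _ * _); field. Qed.

Lemma gspan_scale (S : set C) c f : gspan S f -> gspan S (fun z => c * f z).
Proof.
apply: (gspan_map (T := fun f z => c * f z)).
- by apply/funext => z; rewrite mulr0.
- by move=> g h _ _; apply/funext => z; rewrite mulrDr.
- move=> al be P al0; under eq_fun do rewrite cgaussZ; exact: gspan_cgauss.
Qed.

Lemma CW_shift w f : CW f -> CW (fun z => f (z + w)).
Proof.
apply: (gspan_map (T := fun f z => f (z + w))) => //.
move=> al be P al0; under eq_fun do rewrite cgauss_shift; exact: gspan_cgauss.
Qed.

Lemma CW_expM d f : CW f -> CW (fun z => cexp (d * z) * f z).
Proof.
apply: (gspan_map (T := fun f z => cexp (d * z) * f z)).
- by apply/funext => z; rewrite mulr0.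
- by move=> g h _ _; apply/funext => z; rewrite mulrDr.
- move=> al be P al0; under eq_fun do rewrite cgauss_expM; exact: gspan_cgauss.
Qed.

Lemma gspan_mul (S : set C) f g : (forall al al', S al -> S al' -> S (al + al')) ->
  gspan S f -> gspan S g -> gspan S (fun z => f z * g z).
Proof.
move=> SD + gW; apply: (gspan_map (T := fun f z => f z * g z)).
- by apply/funext => z; rewrite mul0r.
- by move=> ? ? _ _; apply/funext => z; rewrite mulrDl.
move=> al be P al0; move: g gW.
apply: (gspan_map (T := fun g z => cgauss al be P z * g z)).
- by apply/funext => z; rewrite mulr0.
- by move=> ? ? _ _; apply/funext => z; rewrite mulrDr.
- move=> al' be' P' al0'; under eq_fun do rewrite cgaussM.
  by apply: gspan_cgauss; exact: SD.
Qed.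

Lemma CW_mul f g : CW f -> CW g -> CW (fun z => f z * g z).
Proof.
by apply: gspan_mul => al al' al0 al0'; rewrite /half_plane Re_add addr_gt0.
Qed.

Lemma conjM (z w : C) : (z * w)^* = z^* * w^*. Proof. exact: rmorphM. Qed.
Lemma conjD (z w : C) : (z + w)^* = z^* + w^*. Proof. exact: rmorphD. Qed.

Lemma conj_cexp (z : C) : (cexp z)^* = cexp z^*.
Proof.
apply: complexP; rewrite ?cRe_conj ?cIm_conj ?Re_cexp ?Im_cexp cRe_conj cIm_conj.
  by rewrite cosN.
by rewrite sinN mulrN.
Qed.

(** Schwarz reflection: on the real line this is the conjugate of f, but it is entire when f is, so
    that it can be translated off the line. *)
Definition sharp (f : C -> C) : C -> C := fun z => (f z^*)^*.

Lemma conj_real (x : R) : x%:C^* = x%:C :> C.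
Proof. by apply: complexP; rewrite ?cRe_conj ?cIm_conj //= oppr0. Qed.

Lemma CW_sharp f : CW f -> CW (sharp f).
Proof.
apply: gspan_map; first by apply/funext => z; rewrite /sharp rmorph0.
  by move=> g h _ _; apply/funext => z; rewrite /sharp rmorphD.
move=> al be P al0.
rewrite (_ : sharp _ = cgauss al^* be^* (map_poly Num.conj P)).
  by apply: gspan_cgauss; rewrite /half_plane cRe_conj.
apply/funext => z; rewrite /sharp /cgauss conjM conj_cexp; congr (cexp _ * _).
  by rewrite !expr2 conjD !conjM rmorphN fmorphV rmorph_nat conjCK.
by rewrite -[in RHS](conjCK z) horner_map.
Qed.

Lemma CW_gdom f : CW f -> gdom (onR f).
Proof.
elim=> [|al be P {}f al0 _ IH]; first exact: gdom0.
exact: gdomD (cgauss_gdom be P al0) IH.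
Qed.

Lemma CW_cintegrable f : CW f -> cintegrable (onR f).
Proof. by move=> /CW_gdom/gdom_integrable. Qed.

(** Translation lowers be/al by w; composing P with X + w compensates, because [heat] commutes with
    translations, and the exponential constants cancel. *)
Lemma cint_shift w f : CW f -> cint (onR (fun z => f (z + w))) = cint (onR f).
Proof.
elim=> [//|al be P {}f al0 fW IH].
rewrite cintD.
- rewrite IH [RHS]cintD.
  + congr (_ + _).
    rewrite (_ : (fun x : R => _) = onR (cgauss al (be - al * w)
      (cexp (- al * w ^+ 2 / 2 + be * w) *: (P \Po ('X + w%:P))))); last first.
      by apply/funext => x; rewrite cgauss_shift.
    have [lam l0 le] := exists_sqrt al0; rewrite -le in al0 *.
    have lam0 : lam != 0 by apply/eqP => e; move: l0; rewrite e ltxx.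
    rewrite !cint_cgauss// heatZ hornerZ -['X]scale1r heat_comp_affine.
    rewrite expr1n mulr1 scale1r horner_comp hornerD hornerX hornerC.
    rewrite (_ : (be - lam ^+ 2 * w) / lam ^+ 2 + w = be / lam ^+ 2); last by field.
    rewrite mulrA; congr (_ * _).
    rewrite -mulrA -cexpD; congr (_ * cexp _); field.
    by rewrite lam0.
  + exact: CW_cintegrable (gspan_cgauss _ _ al0).
  + exact: CW_cintegrable.
- exact: CW_cintegrable (CW_shift w (gspan_cgauss be P al0)).
- exact: CW_cintegrable (CW_shift w fW).
Qed.

Lemma W_gspan (f : C -> C) : W f <-> gspan half_line f.
Proof.
split=> [[s [sp ->]]|].
  elim: s sp => [|[[A B] P] s IH] /=.
    by move=> _; under eq_fun do rewrite big_nil; exact: gspan0.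
  case/andP=> A0 /IH fW; under eq_fun do rewrite big_cons.
  by apply: gspan_cons fW; exists A.
elim=> [|_ be P {}f [A A0 <-] _ [s [sp fE]]].
  by exists [::]; split=> //; apply/funext => z; rewrite big_nil.
exists ((A, be, P) :: s); split; first by rewrite /= A0.
by rewrite fE; apply/funext => z; rewrite big_cons.
Qed.

Lemma W_CW (f : C -> C) : W f -> CW f.
Proof.
move/W_gspan; apply: (gspan_map (T := id)) => // _ be P [A A0 <-].
exact: gspan_cgauss.
Qed.

Lemma CW_wop e f : CW f -> CW (wop e f).
Proof.
elim: e f => [c|[c|d]|u IHu v IHv|u IHu v IHv] f fW /=.
- exact: gspan_scale.
- exact: CW_shift.
- exact: CW_expM.
- by apply: gspan_add; [exact: IHu|exact: IHv].
- exact: IHu (IHv _ fW).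
Qed.

Lemma inner_integrable f g : CW f -> CW g ->
  cintegrable (fun x => onR f x * (onR g x)^*).
Proof.
move=> fW gW; apply: gdom_integrable; apply: gdomM; first exact: CW_gdom.
exact: gdom_conj (CW_gdom gW).
Qed.

Lemma wop_adj e f g : CW f -> CW g ->
  L2inner (onR (wop e f)) (onR g) = L2inner (onR f) (onR (wop (wadj e) g)).
Proof.
elim: e f g => [c|[c|d]|u IHu v IHv|u IHu v IHv] f g fW gW /=.
- congr cint; apply/funext => x; rewrite /onR conjM conjCK; ring.
(* F(x + ic) = f(x + ic) g(x)^* and F(x) = f(x) g(x + ic)^*: the two sides are integrals of F over
   parallel lines. *)
- pose F z := f z * sharp g (z - c *i).
  have FW : CW F by apply: CW_mul => //; apply/CW_shift/CW_sharp.
  transitivity (cint (onR (fun z => F (z + c *i)))).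
    congr cint; apply/funext => x; rewrite /onR /F addrK /sharp.
    by rewrite conj_real.
  rewrite cint_shift//; congr cint; apply/funext => x.
  rewrite /onR /F /sharp; congr (_ * (g _)^*).
  by apply: complexP; rewrite cRe_conj || rewrite cIm_conj; rewrite /=; ring.
- congr cint; apply/funext => x; rewrite /onR conjM conj_cexp conjM !conj_real.
  by ring.
- rewrite /L2inner.
  under [X in cint X = _]eq_fun do rewrite /onR mulrDl.
  under [X in _ = cint X]eq_fun do rewrite /onR conjD mulrDr.
  rewrite !cintD; [|exact: inner_integrable fW (CW_wop _ gW)..
    |exact: inner_integrable (CW_wop _ fW) gW|exact: inner_integrable (CW_wop _ fW) gW].
  by congr (_ + _); [exact: IHu|exact: IHv].
- rewrite IHu//; last exact: CW_wop.
  by rewrite IHv//; exact: CW_wop.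
Qed.

Lemma wadjK : involutive (@wadj R).
Proof.
by elim=> [c|g|u IHu v IHv|u IHu v IHv] //=; rewrite ?conjCK ?IHu ?IHv.
Qed.

End GaussianSpace.

Notation CW := (gspan (@half_plane _)).

(** * Convolution with imaginary Gaussian kernels *)

Section GaussianKernel.
Variable R : realType.
Local Notation C := R[i].
Local Notation Re := complex.Re.
Local Notation Im := complex.Im.

(** Covers the four kernels, with om = pi i or -pi i and ka = 2 pi a or -2 pi a. The argument is the
    integration variable minus the output variable; with this convention inverse kernels share [ka]
    and have opposite [om]. *)
Definition gker (om ka t : C) : C := cexp (om * t ^+ 2 + ka * t).

(* The argument [z] is complex because [ExpP] evaluates off the real line. *)
Definition gconv (om ka : C) (f : C -> C) (z : C) : C :=
  cint (fun x : R => gker om ka (x%:C - z) * f x%:C).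

Lemma Re_subr_im (al om : C) : Re om = 0 -> Re (al - 2 * om) = Re al.
Proof. by case: om al => o1 o2 [a1 a2] /= ->; ring. Qed.

(** Equivalently 1/al' = 1/al - 1/(2 om): variances add, that of the kernel being imaginary. Under
    [be_conv] the quotient (be + ka)/al is invariant. *)
Definition al_conv (om al : C) : C := - 2 * om * al / (al - 2 * om).
Definition be_conv (om ka al be : C) : C :=
  - ka - 2 * om * (be + ka) / (al - 2 * om).

Variables (om ka : C).
Hypothesis Re_om : Re om = 0.
Hypothesis om2 : om ^+ 2 = - (pi ^+ 2)%:C.

Let om0 : om != 0.
Proof.
apply/eqP => o0; move/eqP: om2; rewrite o0 expr0n /= eq_sym oppr_eq0 => /eqP[].
by move/eqP; rewrite expf_eq0 /= gt_eqF// pi_gt0.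
Qed.

Lemma gker_cgauss (al be : C) P (z x : C) :
  gker om ka (x - z) * cgauss al be P x =
  cexp (om * z ^+ 2 - ka * z) *
  cgauss (al - 2 * om) (be + ka - 2 * om * z) P x.
Proof.
by rewrite /gker /cgauss mulrA [RHS]mulrA -!cexpD; congr (cexp _ * _); field.
Qed.

Let Re_al (al : C) : Re (al - 2 * om) = Re al := Re_subr_im al Re_om.

Let al_neq0 (al : C) : 0 < Re al -> al != 0.
Proof. by move=> al0; apply/eqP => e; move: al0; rewrite e ltxx. Qed.

Lemma CW_gker f z : CW f -> CW (fun x => gker om ka (x - z) * f x).
Proof.
apply: (gspan_map (T := fun f x => gker om ka (x - z) * f x)).
- by apply/funext => x; rewrite mulr0.
- by move=> ? ? _ _; apply/funext => x; rewrite mulrDr.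
- move=> al be P al0; under eq_fun do rewrite gker_cgauss.
  by apply/gspan_scale/gspan_cgauss; rewrite /half_plane Re_al.
Qed.

Lemma gconv_cintegrable f z : CW f ->
  cintegrable (fun x : R => gker om ka (x%:C - z) * f x%:C).
Proof. by move=> fW; exact: CW_cintegrable (CW_gker z fW). Qed.

Lemma gconvD f g : CW f -> CW g ->
  gconv om ka (fun z => f z + g z) = fun z => gconv om ka f z + gconv om ka g z.
Proof.
move=> fW gW; apply/funext => z; rewrite /gconv -cintD; first last.
- exact: gconv_cintegrable.
- exact: gconv_cintegrable.
by congr cint; apply/funext => x; rewrite mulrDr.
Qed.

Lemma gconvZ c f : CW f ->
  gconv om ka (fun z => c * f z) = fun z => c * gconv om ka f z.
Proof.
move=> fW; apply/funext => z; rewrite /gconv -cintZ; last exact: gconv_cintegrable.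
by congr cint; apply/funext => x; rewrite mulrCA.
Qed.

Lemma gconv0 : gconv om ka (fun=> 0) = fun=> 0.
Proof.
apply/funext => z; rewrite /gconv -[RHS](cint0 R).
by congr cint; apply/funext => x; rewrite mulr0.
Qed.

Lemma gconv_cgauss (lam al be : C) P : 0 < Re lam -> lam ^+ 2 = al - 2 * om ->
  0 < Re al ->
  gconv om ka (cgauss al be P) = cgauss (al_conv om al) (be_conv om ka al be)
    (((Num.sqrt (pi *+ 2))%:C / lam * cexp ((be + ka) ^+ 2 / (2 * (al - 2 * om)))) *:
     (heat (al - 2 * om)^-1 P \Po
       ((- 2 * om / (al - 2 * om)) *: 'X + ((be + ka) / (al - 2 * om))%:P))).
Proof.
move=> l0 le al0; have A0 : 0 < Re (al - 2 * om) by rewrite Re_al.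
have An0 := al_neq0 A0.
apply/funext => z; rewrite /gconv.
rewrite (_ : (fun x : R => _) = fun x => cexp (om * z ^+ 2 - ka * z) *
  onR (cgauss (al - 2 * om) (be + ka - 2 * om * z) P) x); last first.
  by apply/funext => x; rewrite gker_cgauss.
rewrite cintZ; last by apply/gdom_integrable/cgauss_gdom.
rewrite -cgaussZ /cgauss -le in A0 An0 *; rewrite cint_cgauss//.
rewrite horner_comp hornerD hornerZ hornerX hornerC.
have -> : (be + ka - 2 * om * z) / lam ^+ 2 =
  - 2 * om / lam ^+ 2 * z + (be + ka) / lam ^+ 2 by ring.
have alE : al = lam ^+ 2 + 2 * om by rewrite le subrK.
(* Collecting the powers of z in the exponent is the origin of [al_conv] and [be_conv]. *)
have e : cexp (om * z ^+ 2 - ka * z) *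
    cexp ((be + ka - 2 * om * z) ^+ 2 / (2 * lam ^+ 2)) =
  cexp ((be + ka) ^+ 2 / (2 * lam ^+ 2)) *
    cexp (- al_conv om al * z ^+ 2 / 2 + be_conv om ka al be * z).
  rewrite -!cexpD; congr cexp; rewrite /al_conv /be_conv -le alE; field.
  by apply/eqP => e; rewrite e expr0n eqxx in An0.
move: e (_.[_]) => + u.
move: (cexp _) (cexp _) (cexp _) (cexp _) => e1 e2 e3 e4 e; ring: e.
Qed.

Lemma Re_al_conv (al : C) : 0 < Re al -> 0 < Re (al_conv om al).
Proof.
have y0 : Im om != 0.
  by apply/eqP => e; move: om0; rewrite (_ : om = 0) ?eqxx//; exact: complexP.
have omE : om = 0 +i* Im om by apply: complexP.
rewrite /al_conv omE; move: (Im om) y0; case: al => a c y y0 a0.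
have {}a0 : 0 < a := a0.
have d0 : 0 < a ^+ 2 + (c - 2 * y) ^+ 2 by rewrite ltr_pwDl ?exprn_gt0 ?sqr_ge0.
rewrite (_ : Re _ = 4 * y ^+ 2 * a / (a ^+ 2 + (c - 2 * y) ^+ 2)).
  have y2 : 0 < y ^+ 2 by rewrite exprn_even_gt0.
  by apply: divr_gt0 => //; apply: mulr_gt0 => //; apply: mulr_gt0.
rewrite /= !(mul0r, mulr0, add0r, addr0, subr0, sub0r, oppr0).
by field; rewrite gt_eqF.
Qed.

Lemma CW_gconv f : CW f -> CW (gconv om ka f).
Proof.
apply: gspan_map; [exact: gconv0|exact: gconvD|move=> al be P al0].
have [lam l0 le] : exists2 lam, 0 < Re lam & lam ^+ 2 = al - 2 * om.
  by apply: exists_sqrt; rewrite Re_al.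
by rewrite (gconv_cgauss _ _ l0 le al0); apply/gspan_cgauss/Re_al_conv.
Qed.

(** The kernel depends on x - z only, so translating the output by a complex w amounts to
    translating the contour of x. *)
Lemma gconv_shift w f : CW f ->
  gconv om ka (fun z => f (z + w)) = fun z => gconv om ka f (z + w).
Proof.
move=> fW; apply/funext => z.
have := cint_shift w (CW_gker (z + w) fW); rewrite /gconv => <-.
by congr cint; apply/funext => x; rewrite /onR opprD addrACA subrr addr0.
Qed.

End GaussianKernel.

(** * Inversion of the convolutions *)

Lemma comp_affine_id (K : comNzRingType) (s1 s0 t1 t0 : K) :
  s1 * t1 = 1 -> s1 * t0 + s0 = 0 ->
  (s1 *: 'X + s0%:P) \Po (t1 *: 'X + t0%:P) = 'X.
Proof.
move=> e1 e0; rewrite comp_polyD comp_polyZ comp_polyC comp_polyX scalerDr.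
rewrite scalerA e1 scale1r -[s1 *: _]mul_polyC -polyCM -addrA -polyCD e0.
by rewrite addr0.
Qed.

Section GaussianKernelInverse.
Variable R : realType.
Local Notation C := R[i].
Local Notation Re := complex.Re.
Local Notation Im := complex.Im.
Variables (om ka : C).
Hypothesis Re_om : Re om = 0.
Hypothesis om2 : om ^+ 2 = - (pi ^+ 2)%:C.

(** [om2] is the normalization: the second quadratic coefficient -4 om^2/lam^2 is then (2 pi/lam)^2,
    and the prefactors sqrt(2 pi)/lam and sqrt(2 pi)/(2 pi/lam) have product 1. *)
Lemma gconvK f : CW f -> gconv (- om) ka (gconv om ka f) = f.
Proof.
have Re_om' : Re (- om) = 0 by move: Re_om; case: (om) => ? ? /= ->; rewrite oppr0.
have om2' : (- om) ^+ 2 = - (pi ^+ 2)%:C by rewrite sqrrN.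
have pi0 : (pi : R) != 0 by rewrite gt_eqF// pi_gt0.
have om0 : om != 0.
  apply/eqP => o0; move/eqP: om2; rewrite o0 expr0n /= eq_sym oppr_eq0 => /eqP[].
  by move/eqP; rewrite expf_eq0 /= (negbTE pi0).
elim=> [|al be P {}f al0 fW IH]; first by rewrite !gconv0.
rewrite gconvD//; last exact: gspan_cgauss.
rewrite gconvD//; [|exact/CW_gconv/gspan_cgauss|exact: CW_gconv].
rewrite IH; apply/funext => z; congr (_ + _).
have A0 : 0 < Re (al - 2 * om).
  by rewrite Re_subr_im.
have [lam l0 le] := exists_sqrt A0.
have lam0 : lam != 0 by apply/eqP => e; move: l0; rewrite e ltxx.
have alE : al = lam ^+ 2 + 2 * om by rewrite le subrK.
(* The square root for the second integral, on the right branch because inversion preserves the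
   right half-plane. *)
have l0' : 0 < Re ((2 * pi)%:C / lam).
  have -> : Re ((2 * pi)%:C / lam) = 2 * pi * Re lam / (Re lam ^+ 2 + Im lam ^+ 2).
    by case: (lam) => u v /=; ring.
  apply: divr_gt0; last by rewrite ltr_pwDl ?exprn_gt0 ?sqr_ge0.
  by apply: mulr_gt0 => //; apply: mulr_gt0 => //; exact: pi_gt0.
have le' : ((2 * pi)%:C / lam) ^+ 2 = al_conv om al - 2 * - om.
  rewrite /al_conv -le alE; transitivity (- 4 * om ^+ 2 / lam ^+ 2).
    by rewrite om2 rmorphM rmorphXn rmorph_nat; field.
  by field.
rewrite (gconv_cgauss ka Re_om be P l0 le al0).
rewrite (gconv_cgauss ka Re_om' _ _ l0' le'); last exact: Re_al_conv.
have A' : al_conv om al - 2 * - om = - 4 * om ^+ 2 / lam ^+ 2.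
  by rewrite /al_conv -le alE; field.
rewrite A' heatZ.
have -> : al_conv (- om) (al_conv om al) = al.
  by rewrite {1}/al_conv A' /al_conv -le alE; field; rewrite lam0 om0.
have -> : be_conv (- om) ka (al_conv om al) (be_conv om ka al be) = be.
  by rewrite {1}/be_conv A' /be_conv -le; field; rewrite lam0 om0.
rewrite heat_comp_affine heat_heat.
(* Moved through the affine substitution, the second heat time is multiplied by the square of the
   slope and becomes opposite to the first. *)
have -> : (al - 2 * om)^-1 + (- 4 * om ^+ 2 / lam ^+ 2)^-1 * (- 2 * om / (al - 2 * om)) ^+ 2 = 0.
  by rewrite -le; field; rewrite lam0 om0.
rewrite heat_id comp_polyZ scalerA -comp_polyA.
rewrite comp_affine_id; first last.
- by rewrite /be_conv -le; field; rewrite lam0 om0.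
- by rewrite -le; field; rewrite lam0 om0.
rewrite comp_polyXr -[in LHS]cgaussZ -[RHS]mul1r; congr (_ * _).
rewrite mulrACA -cexpD.
have -> : (be_conv om ka al be + ka) ^+ 2 / (2 * (- 4 * om ^+ 2 / lam ^+ 2)) +
   (be + ka) ^+ 2 / (2 * (al - 2 * om)) = 0.
  by rewrite /be_conv -le; field; rewrite lam0 om0.
have -> : cexp (0 : C) = 1 by rewrite (_ : 0 = 0%:C)// cexp_real expR0.
rewrite mulr1; set s := (Num.sqrt _)%:C.
have s2 : s ^+ 2 = (2 * pi)%:C.
  by rewrite /s -rmorphXn sqr_sqrtr ?mulr_natl// mulrn_wge0// pi_ge0.
have s0 : s != 0.
  apply/eqP => -[/eqP]; rewrite sqrtr_eq0 leNgt mulrn_wgt0 ?pi_gt0//.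
by rewrite -s2; field; rewrite lam0 s0.
Qed.

End GaussianKernelInverse.

(** * Polynomial thresholds *)

Section GaussianThreshold.
Variable R : realType.

Lemma bernoulli_ineq (t : R) n : -1 <= t -> 1 + n%:R * t <= (1 + t) ^+ n.
Proof.
move=> t1; elim: n => [|n IH]; first by rewrite mul0r addr0 expr0.
rewrite exprS; have t0 : 0 <= 1 + t by lra.
apply: le_trans (ler_wpM2l t0 IH).
have : 0 <= n%:R * t ^+ 2 by rewrite mulr_ge0// sqr_ge0.
rewrite -natr1; lra.
Qed.

Lemma cvg_natM_expr (z : R) : 0 <= z < 1 -> n%:R * z ^+ n @[n --> \oo] --> (0 : R).
Proof.
(* As z <= s^2 and s < 1, n z^n <= (n s^n) s^n, where n s^n is bounded by Bernoulli's inequality. *)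
move=> /andP[z0 z1]; pose s := Num.sqrt ((1 + z) / 2).
have s2 : s ^+ 2 = (1 + z) / 2 by rewrite sqr_sqrtr// divr_ge0// addr_ge0.
have s0 : 0 < s by rewrite sqrtr_gt0 divr_gt0// ltr_pwDl.
have s1 : s < 1 by rewrite -sqrtr1 ltr_sqrt// ltr_pdivrMr//; lra.
have h0 : 0 < s^-1 - 1 by rewrite subr_gt0 invf_gt1.
have B n : n%:R * s ^+ n <= (s^-1 - 1)^-1.
  have := @bernoulli_ineq (s^-1 - 1) n; rewrite [1 + (_ - 1)]addrC subrK exprVn => H.
  have {}H : n%:R * (s^-1 - 1) <= s ^- n.
    apply: le_trans (H _); rewrite ?lerDr//; lra.
  rewrite -[leRHS]mul1r ler_pdivlMr// mulrAC.
  by rewrite -ler_pdivlMr ?exprn_gt0// mul1r.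
apply: (@squeeze_cvgr _ _ _ _ (fun=> 0) (fun n => (s^-1 - 1)^-1 * s ^+ n)).
- near=> n; rewrite mulr_ge0 ?exprn_ge0//=.
  apply: le_trans (ler_wpM2r (exprn_ge0 n (ltW s0)) (B n)).
  rewrite -mulrA ler_wpM2l// -exprD addnn -mul2n exprM s2.
  by rewrite lerXn2r ?nnegrE ?divr_ge0 ?addr_ge0//; lra.
- exact: cvg_cst.
- rewrite -[X in _ --> X](mulr0 (s^-1 - 1)^-1); apply: cvgMl_tmp.
  by apply: cvg_expr; rewrite ger0_norm// ltW.
Unshelve. all: end_near. Qed.

(* Stone-Weierstrass-like thresholds: polynomials without constant term which
   converge on [0, 1] to the indicator function of [1/2, 1]. *)
Definition threshold n (u : R) : R := 1 - (1 - u ^+ n) ^+ (n * 2 ^ n).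

Section bounds.
Variable u : R.
Hypothesis u01 : 0 <= u <= 1.

Let un n : 0 <= u ^+ n <= 1.
Proof. by case/andP: u01 => u0 u1; rewrite exprn_ge0//= exprn_ile1. Qed.

Lemma threshold_ge0 n : 0 <= threshold n u.
Proof.
have /andP[a0 a1] := un n.
by rewrite subr_ge0 exprn_ile1 ?subr_ge0// lerBlDr lerDl.
Qed.

Lemma threshold_le1 n : threshold n u <= 1.
Proof.
by have /andP[a0 a1] := un n; rewrite lerBlDr lerDl exprn_ge0// subr_ge0.
Qed.

Lemma threshold_le_pow n : threshold n u <= n%:R * (2 * u) ^+ n.
Proof.
have /andP[a0 a1] := un n.
have := @bernoulli_ineq (- u ^+ n) (n * 2 ^ n); rewrite lerN2 a1 => /(_ isT).
rewrite /threshold exprMn natrM natrX mulrN; lra.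
Qed.

(** Uniform in n and linear in u: for a Gaussian u this is the square-integrable majorant. For u <
    1/4 and n > 0 it follows from n (2u)^n = 2u n (2u)^(n-1) and n <= 2^(n-1). *)
Lemma threshold_le n : threshold n u <= 4 * u.
Proof.
case/andP: u01 => u0 u1.
have [u4|u4] := leP (1 / 4) u.
  by apply: le_trans (threshold_le1 n) _; lra.
apply: le_trans (threshold_le_pow n) _; case: n => [|n].
  by rewrite mul0r mulr_ge0.
apply: (@le_trans _ _ (2 * u)); last by lra.
rewrite exprS mulrCA -[leRHS]mulr1 ler_wpM2l ?mulr_ge0//.
apply: (@le_trans _ _ ((2 ^ n)%:R * (1 / 2) ^+ n)).
  apply: ler_pM => //; first by rewrite exprn_ge0// mulr_ge0.
    by rewrite ler_nat ltn_expl.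
  by apply: lerXn2r; rewrite ?nnegrE ?mulr_ge0//; lra.
by rewrite natrX -exprMn mul1r divff// expr1n.
Qed.

(** The exponent n 2^n makes (1 - u^n)^(n 2^n) at most exp(-n (2u)^n). For u >= 1/2 this is at most
    exp(-n), the factor n deciding the case u = 1/2; for u < 1/2, [threshold_le_pow] gives the limit
    0. *)
Lemma cvg_threshold : threshold n u @[n --> \oo] --> ((2^-1 <= u)%R%:R : R).
Proof.
case/andP: u01 => u0 u1.
have [u2|u2] := leP 2^-1 u; last first.
  apply: (@squeeze_cvgr _ _ _ _ (fun=> 0) (fun n => n%:R * (2 * u) ^+ n)).
  - by near=> n; rewrite threshold_ge0 threshold_le_pow.
  - exact: cvg_cst.
  - by apply: cvg_natM_expr; rewrite mulr_ge0//=; lra.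
apply: (@squeeze_cvgr _ _ _ _ (fun n => 1 - expR (- 1) ^+ n) (fun=> 1)).
- near=> n; rewrite threshold_le1 andbT lerD2l lerN2.
  have /andP[a0 a1] := un n.
  apply: (@le_trans _ _ (expR (- u ^+ n) ^+ (n * 2 ^ n))).
    by apply: lerXn2r; rewrite ?nnegrE ?subr_ge0 ?expR_ge0// expR_ge1Dx.
  rewrite -!expRM_natl ler_expR mulrN mulrN1 lerN2 natrM natrX -mulrA -exprMn.
  rewrite -[leLHS]mulr1 ler_wpM2l// exprn_ege1//; lra.
- rewrite -[X in _ --> X]subr0; apply: cvgB; first exact: cvg_cst.
  by apply: cvg_expr; rewrite ger0_norm ?expR_ge0// expR_lt1; lra.
- exact: cvg_cst.
Unshelve. all: end_near. Qed.

End bounds.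

End GaussianThreshold.

(** * Approximation of interval indicators in L^2 *)

Section Density.
Variable R : realType.
Local Notation C := R[i].
Local Notation Re := complex.Re.
Local Notation Im := complex.Im.
Local Notation mu := (@lebesgue_measure R).

Lemma real_complexD (x y : R) : (x + y)%:C = x%:C + y%:C :> C.
Proof. exact: rmorphD. Qed.
Lemma real_complexN (x : R) : (- x)%:C = - x%:C :> C.
Proof. exact: rmorphN. Qed.
Lemma real_complexM (x y : R) : (x * y)%:C = x%:C * y%:C :> C.
Proof. exact: rmorphM. Qed.

(** A real algebra without unit, since nonzero constants do not decay; hence thresholds without
    constant term. *)
Definition realW (v : R -> R) : Prop :=
  exists2 w, W w & forall x, onR w x = (v x)%:C.

Lemma realW_add v w : realW v -> realW w -> realW (fun x => v x + w x).
Proof.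
move=> [f fW fE] [g gW gE]; exists (fun z => f z + g z).
  by apply/W_gspan/gspan_add; apply/W_gspan.
by move=> x; rewrite real_complexD -fE -gE.
Qed.

Lemma realW_scale c v : realW v -> realW (fun x => c * v x).
Proof.
move=> [f fW fE]; exists (fun z => c%:C * f z).
  by apply/W_gspan/gspan_scale; apply/W_gspan.
by move=> x; rewrite real_complexM -fE.
Qed.

Lemma realW_mul v w : realW v -> realW w -> realW (fun x => v x * w x).
Proof.
move=> [f fW fE] [g gW gE]; exists (fun z => f z * g z).
  apply/W_gspan/gspan_mul; try exact/W_gspan.
  move=> _ _ [A A0 <-] [B B0 <-]; exists (A + B); last exact: rmorphD.
  exact: addr_gt0.
by move=> x; rewrite real_complexM -fE -gE.
Qed.

Lemma realW0 : realW (fun=> 0).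
Proof. by exists (fun=> 0) => //; apply/W_gspan; exact: gspan0. Qed.

Lemma realW_gauss (A c : R) : 0 < A -> realW (fun x => expR (- A * (x - c) ^+ 2)).
Proof.
move=> A0; exists (fun z => cexp (- (2 * A)%:C * z ^+ 2 / 2 + (2 * A * c)%:C * z) *
    ((expR (- A * c ^+ 2))%:C)%:P.[z]).
  by apply/W_gspan/gspan_cgauss; exists (2 * A) => //; rewrite mulr_gt0.
move=> x; rewrite /onR hornerC -[(expR _)%:C]cexp_real -cexpD -cexp_real.
congr cexp; rewrite (_ : - A * (x - c) ^+ 2 =
  - (2 * A) * x * x * 2^-1 + 2 * A * c * x + - A * c ^+ 2); last by field.
rewrite !real_complexD !real_complexM !real_complexN !real_complexM fmorphV !rmorph_nat.
by ring.
Qed.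

Lemma realW_threshold n A c : 0 < A ->
  realW (fun x => threshold n (expR (- A * (x - c) ^+ 2))).
Proof.
(* For n = 0 the inner power is the constant 1, outside [realW], but the outer exponent is 0 as well
   and the threshold vanishes. *)
move=> A0; have [n0|n0] := posnP n.
  rewrite (_ : (fun _ => _) = fun=> 0); first exact: realW0.
  by apply/funext => x; rewrite /threshold n0 expr0 subrr.
have uV : realW (fun x => expR (- A * (x - c) ^+ 2) ^+ n).
  case: n n0 => // n _; elim: n => [|n IH]; first exact: realW_gauss.
  by under eq_fun do rewrite exprS; apply: realW_mul IH; exact: realW_gauss.
rewrite /threshold; elim: (n * 2 ^ n)%N => [|m IH].
  rewrite (_ : (fun _ => _) = fun=> 0); first exact: realW0.
  by apply/funext => x; rewrite expr0 subrr.
set v := fun x => _ ^+ n in uV *; set q := fun x => _ in IH.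
(* 1 - (1 - v)^(m+1) = v + q - v q with q = 1 - (1 - v)^m, so the constants cancel at each step. *)
rewrite (_ : (fun _ => _) = fun x => (v x + q x) + -1 * (v x * q x)).
  apply: realW_add; first exact: realW_add.
  by apply: realW_scale; exact: realW_mul.
by apply/funext => x; rewrite exprS /v /q; ring.
Qed.

Lemma realW_integrable v : realW v -> mu.-integrable setT (EFin \o v).
Proof.
move=> [f /W_CW fW fE]; have [f1 _] := CW_cintegrable fW.
by move: f1; congr (mu.-integrable _ _); apply/funext => x /=; rewrite fE.
Qed.

Lemma realW_measurable v : realW v -> measurable_fun setT v.
Proof. by move=> /realW_integrable/integrableP[/measurable_EFinP]. Qed.

Lemma realW_sqr v : realW v -> mu.-integrable setT (EFin \o (fun x => v x ^+ 2)).
Proof. by move=> vV; under eq_fun do rewrite expr2; exact/realW_integrable/realW_mul. Qed.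

Lemma integral_sqrD_le (f g : R -> R) : measurable_fun setT f ->
  measurable_fun setT g ->
  (\int[mu]_x ((f x + g x) ^+ 2)%:E <=
   2%:E * \int[mu]_x (f x ^+ 2)%:E + 2%:E * \int[mu]_x (g x ^+ 2)%:E)%E.
Proof.
move=> mf mg.
have m2 (h : R -> R) : measurable_fun setT h -> measurable_fun setT (fun x => (h x ^+ 2)%:E).
  by move=> mh; apply/measurable_EFinP; exact: measurable_funX.
have p2 (h : R -> R) x : (0 <= (h x ^+ 2)%:E)%E by rewrite lee_fin sqr_ge0.
rewrite -!ge0_integralZl_EFin//; [|exact: m2..].
rewrite -ge0_integralD//; first last.
- by apply: emeasurable_funM => //; exact: m2.
- by move=> x _; rewrite mule_ge0.
- by apply: emeasurable_funM => //; exact: m2.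
- by move=> x _; rewrite mule_ge0.
apply: ge0_le_integral; first exact: measurableT.
- by move=> x _; exact: (p2 (fun x => f x + g x)).
- by apply: (m2 (fun x => f x + g x)); exact: measurable_funD.
- by apply: emeasurable_funD; apply: emeasurable_funM => //; exact: m2.
move=> x _; rewrite -!EFinM -EFinD lee_fin.
have := sqr_ge0 (f x - g x); nra.
Qed.

(** The L^2 closure of [realW], with squared distances in the extended reals: [integral_sqrD_le]
    stands in for Minkowski's inequality. *)
Definition adherent (g : R -> R) : Prop := measurable_fun setT g /\
  forall e : R, 0 < e -> exists2 v, realW v &
    (\int[mu]_x ((g x - v x) ^+ 2)%:E < e%:E)%E.

Lemma realW_adherent v : realW v -> adherent v.
Proof.
move=> vV; split; first exact: realW_measurable.
move=> e e0; exists v => //.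
under eq_integral do rewrite subrr expr0n /=.
by rewrite integral0 lte_fin.
Qed.

Let sum_lt (a c : \bar R) (e : R) : (0 <= a)%E -> (0 <= c)%E ->
  (a < (e / 4)%:E)%E -> (c < (e / 4)%:E)%E -> (2%:E * a + 2%:E * c < e%:E)%E.
Proof.
move=> a0 c0 al cl.
have af : a \is a fin_num by rewrite ge0_fin_numE// (lt_trans al)// ltry.
have cf : c \is a fin_num by rewrite ge0_fin_numE// (lt_trans cl)// ltry.
move: al cl; rewrite -(fineK af) -(fineK cf) !lte_fin => al cl.
lra.
Qed.

Let int_sqr_ge0 (f : R -> R) : (0 <= \int[mu]_x (f x ^+ 2)%:E)%E.
Proof. by apply: integral_ge0 => x _; rewrite lee_fin sqr_ge0. Qed.

Lemma adherent_add f g : adherent f -> adherent g -> adherent (fun x => f x + g x).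
Proof.
move=> [mf fA] [mg gA]; split; first exact: measurable_funD.
move=> e e0; have e4 : 0 < e / 4 by rewrite divr_gt0.
have [v vV fv] := fA _ e4; have [w wV gw] := gA _ e4.
exists (fun x => v x + w x); first exact: realW_add.
have mfv := measurable_funB mf (realW_measurable vV).
have mgw := measurable_funB mg (realW_measurable wV).
apply: le_lt_trans (sum_lt (int_sqr_ge0 _) (int_sqr_ge0 _) fv gw).
apply: le_trans (integral_sqrD_le mfv mgw).
by under eq_integral do rewrite opprD addrACA.
Qed.

Lemma adherent_scale c f : adherent f -> adherent (fun x => c * f x).
Proof.
move=> [mf fA]; split; first exact: measurable_funM.
move=> e e0; have c0 : 0 < c ^+ 2 + 1 by rewrite ltr_wpDl// sqr_ge0.
have [v vV fv] := fA _ (divr_gt0 e0 c0).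
exists (fun x => c * v x); first exact: realW_scale.
have mfv := measurable_funB mf (realW_measurable vV).
under eq_integral do rewrite -mulrBr exprMn EFinM.
rewrite ge0_integralZl_EFin ?sqr_ge0//; first last.
- by apply/measurable_EFinP; exact: measurable_funX.
- by move=> x _; rewrite lee_fin sqr_ge0.
move: fv (int_sqr_ge0 (fun x => f x - v x)).
case: (\int[mu]_x _)%E => [I| |]//; rewrite lee_fin lte_fin ltr_pdivlMr// => I1 I0.
by rewrite -EFinM lte_fin; nra.
Qed.

(** Dominated convergence for (g - g_n)^2 <= 4 h^2. Intervals, measurable sets and nonnegative
    functions are all reached through this closure property. *)
Lemma adherent_lim (g_ : nat -> R -> R) (g h : R -> R) :
  (forall n, adherent (g_ n)) -> (forall x, g_ n x @[n --> \oo] --> g x) ->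
  mu.-integrable setT (EFin \o (fun x => h x ^+ 2)) ->
  (forall n x, `|g_ n x| <= h x) -> adherent g.
Proof.
move=> gA gcvg hi gh.
have mg_ n : measurable_fun setT (g_ n) by have [] := gA n.
have mg : measurable_fun setT g.
  by apply: (@measurable_fun_cvg _ _ _ _ g_) => // x _; exact: gcvg.
have h0 x : 0 <= h x by apply: le_trans (gh 0 x).
have ghl x : `|g x| <= h x.
  have c : `|g_ n x| @[n --> \oo] --> `|g x| by apply: cvg_norm; exact: gcvg.
  rewrite -(cvg_lim (@Rhausdorff R) c); apply: limr_le; first by apply/cvg_ex; eexists; exact: c.
  by apply: nearW => n; exact: gh.
split=> // e e0; have e4 : 0 < e / 4 by rewrite divr_gt0.
have c0 : (\int[mu]_x ((g x - g_ n x) ^+ 2)%:E)%E @[n --> \oo] -->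
    (\int[mu]_(x in [set: R]) (0 : R)%:E)%E.
  apply: (@dominated_cvg _ _ _ mu setT measurableT
    (fun n x => ((g x - g_ n x) ^+ 2)%:E) _ (fun x => (4 * h x ^+ 2)%:E)) => //.
  - move=> n; apply/measurable_EFinP.
    exact: (measurable_funX 2 (measurable_funB mg (mg_ n))).
  - move=> x _; apply: cvg_EFin; first exact: nearW.
    have gx : g x - g_ n x @[n --> \oo] --> (0 : R).
      rewrite -[X in _ --> X](subrr (g x)).
      by apply: cvgB; [exact: cvg_cst|exact: gcvg].
    have gx2 : (g x - g_ n x) * (g x - g_ n x) @[n --> \oo] --> (0 * 0 : R).
      exact: cvgM.
    by rewrite mulr0 in gx2; exact: gx2.
  - by have := integrableZl measurableT 4 hi.
  - move=> n x _; rewrite /= lee_fin ger0_norm ?sqr_ge0//.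
    have : `|g x - g_ n x| <= 2 * h x.
      have := ler_normB (g x) (g_ n x); have := ghl x; have := gh n x; lra.
    rewrite -[(_ - _) ^+ 2]real_normK ?num_real// => H.
    have -> : 4 * h x ^+ 2 = (2 * h x) ^+ 2 by ring.
    by apply: lerXn2r H; rewrite nnegrE// mulr_ge0.
rewrite integral0 in c0.
have /fine_cvgP[fn cf] := c0.
have [n [nfin nlt]] : exists n, (\int[mu]_x ((g x - g_ n x) ^+ 2)%:E)%E \is a fin_num
    /\ fine (\int[mu]_x ((g x - g_ n x) ^+ 2)%:E)%E < e / 4.
  near \oo => n; exists n; split; first by near: n; exact: fn.
  by near: n; exact: (cvgr_lt _ cf).
have [_ gnA] := gA n; have [v vV gv] := gnA _ e4; exists v => //.
have m1 := measurable_funB mg (mg_ n).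
have m2 := measurable_funB (mg_ n) (realW_measurable vV).
have gn : (\int[mu]_x ((g x - g_ n x) ^+ 2)%:E < (e / 4)%:E)%E.
  by rewrite -(fineK nfin) lte_fin.
apply: le_lt_trans (sum_lt (int_sqr_ge0 _) (int_sqr_ge0 _) gn gv).
apply: le_trans (integral_sqrD_le m1 m2).
by under [X in (_ <= X)%E]eq_integral do rewrite addrA subrK.
Unshelve. all: end_near. Qed.

Lemma adherent_sum (I : Type) (s : seq I) (F : I -> R -> R) :
  (forall i, adherent (F i)) -> adherent (fun x => \sum_(i <- s) F i x).
Proof.
move=> FA; elim: s => [|i s IH].
  by under eq_fun do rewrite big_nil; exact/realW_adherent/realW0.
by under eq_fun do rewrite big_cons; exact: adherent_add.
Qed.

Lemma indic_le (A B : set R) x : A `<=` B -> (\1_A x : R) <= \1_B x.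
Proof.
move=> AB; rewrite !indicE; case: (boolP (x \in A)) => [/set_mem/AB/mem_set ->//|].
by move=> _; rewrite ler0n.
Qed.

Lemma integrable_indic_sqr (a d : R) :
  mu.-integrable setT (EFin \o (fun x => (\1_(`[a, d]%classic) x : R) ^+ 2)).
Proof.
rewrite (_ : _ \o _ = EFin \o \1_(`[a, d]%classic)); last first.
  by apply/funext => x /=; rewrite indicE; case: (_ \in _); rewrite ?expr1n ?expr0n.
exact: integrable_indic_itv.
Qed.

Lemma adherent_itv (a d : R) : adherent (\1_(`[a, d]%classic)).
Proof.
have main (a' d' : R) : a' < d' -> adherent (\1_(`[a', d']%classic)).
  move=> ad; pose c := (a' + d') / 2; pose r := (d' - a') / 2.
  have r0 : 0 < r by rewrite divr_gt0// subr_gt0.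
  have ln2 : 0 < ln (2 : R) by rewrite ln_gt0 ?ltr1n.
  (* Chosen so that the bump equals 1/2 at both endpoints, hence is at least 1/2 exactly on the
     closed interval. *)
  pose A := ln 2 / r ^+ 2; have A0 : 0 < A by rewrite divr_gt0// exprn_gt0.
  pose u x := expR (- A * (x - c) ^+ 2).
  have u01 x : 0 <= u x <= 1.
    by rewrite expR_ge0/= -expR0 ler_expR mulNr oppr_le0 mulr_ge0 ?sqr_ge0// ltW.
  have uE x : (2^-1 <= u x) = (x \in `[a', d']%classic).
    have -> : 2^-1 = expR (- ln 2) :> R by rewrite expRN lnK ?posrE.
    rewrite ler_expR mulNr lerN2 /A mulrAC ler_pdivrMr ?exprn_gt0//.
    rewrite ler_pM2l//.
    have -> : (x \in `[a', d']%classic) = (a' <= x <= d').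
      by apply/idP/idP; rewrite inE /= in_itv.
    have -> : ((x - c) ^+ 2 <= r ^+ 2) = (`|x - c| <= r).
      by rewrite -[(x - c) ^+ 2]real_normK ?num_real// ler_sqr// nnegrE ltW.
    by rewrite ler_norml; apply/idP/idP; rewrite /c /r => /andP[? ?]; lra.
  have uV : realW u by exact: realW_gauss.
  apply: (@adherent_lim (fun n x => threshold n (u x)) _ (fun x => 4 * u x)).
  - by move=> n; apply/realW_adherent/realW_threshold.
  - by move=> x; rewrite indicE -uE; exact: cvg_threshold.
  - by apply/realW_sqr/realW_scale.
  - by move=> n x; rewrite ger0_norm ?threshold_ge0// threshold_le.
have [ad|ad|->] := ltgtP a d; first exact: main.
  rewrite set_itv_ge -?leNgt ?bnd_simp// indic0.
  exact/realW_adherent/realW0.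
(* A single point is the intersection of a decreasing sequence of nondegenerate intervals. *)
apply: (@adherent_lim (fun n => \1_(`[d, d + n.+1%:R^-1]%classic)) _
  (\1_(`[d, d + 1]%classic))).
- by move=> n; apply: main; rewrite ltrDl invr_gt0.
- move=> x; rewrite [X in _ --> X]indicE.
  have [xd|xd] := eqVneq x d.
    rewrite mem_set /=; last by rewrite xd in_itv /= lexx.
    apply: cvg_near_cst; near=> n; rewrite indicE mem_set//= xd in_itv /= lexx /=.
    by rewrite lerDl.
  rewrite memNset /=; last by rewrite in_itv /= -eq_le eq_sym; exact/negP.
  have [xd'|xd'] := ltP x d.
    apply: cvg_near_cst; near=> n; rewrite indicE memNset//= in_itv /=.
    by rewrite leNgt xd'.
  have xd0 : 0 < x - d by rewrite subr_gt0 lt_neqAle eq_sym xd.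
  apply: cvg_near_cst; near=> n; rewrite indicE memNset//= in_itv /= xd' /=.
  apply/negP; rewrite -ltNge -ltrBrDl invf_plt ?posrE//.
  rewrite (lt_trans _ (_ : n%:R < _)) ?ltr_nat//.
  by near: n; exact: nbhs_infty_gtr.
- exact: integrable_indic_sqr.
- move=> n x; rewrite ger0_norm//; apply: indic_le.
  by apply: subset_itvl; rewrite bnd_simp lerD2l invf_le1// ler1n.
Unshelve. all: end_near. Qed.

End Density.

(** * Density of W in L^2 *)

Section DensityInL2.
Variable R : realType.
Local Notation C := R[i].
Local Notation Re := complex.Re.
Local Notation Im := complex.Im.
Local Notation mu := (@lebesgue_measure R).

(** Dynkin's pi-lambda theorem, starting from closed half-lines. Truncation to [-N, N] keeps
    everything square-integrable, so that complements become differences and disjoint unions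
    dominated limits. *)
Lemma adherent_indic (A : set R) (N : R) : measurable A ->
  adherent (\1_(A `&` `[- N, N]%classic)).
Proof.
move=> mA; move: N.
have indI (B D : set R) x : (\1_(B `&` D) x : R) = \1_B x * \1_D x.
  by rewrite !indicE in_setI -natrM mulnb.
have sq1 (N : R) := @integrable_indic_sqr R (- N) N.
apply: (@dynkin_induction _ (measurableTypeR R) (@RGenCInfty.G R)
   (fun A => forall N, adherent (\1_(A `&` `[- N, N]%classic)))).
- exact: RGenCInfty.measurableE.
- move=> _ _ [x ->] [y ->]; exists (Num.max x y).
  apply/seteqP; split=> z /=; rewrite !in_itv /= !andbT ge_max.
    by case=> -> ->.
  by case/andP.
- by move=> N; rewrite setTI; exact: adherent_itv.
- move=> _ [x ->] N.
  rewrite (_ : _ `&` _ = `[Num.max x (- N), N]%classic); first exact: adherent_itv.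
  apply/seteqP; split=> z /=; rewrite !in_itv /= ?andbT ge_max.
    by case=> -> /andP[-> ->].
  by case/andP=> /andP[-> ->] ->.
- move=> S _ SP N.
  rewrite (_ : \1_ _ = fun x => \1_(`[- N, N]%classic) x + -1 * \1_(S `&` `[- N, N]%classic) x).
    by apply: adherent_add; [exact: adherent_itv|exact: adherent_scale].
  apply/funext => x; rewrite !indI !indicE in_setC.
  by case: (x \in S); case: (x \in _); rewrite /=; ring.
- move=> F mF tF FP N.
  apply: (@adherent_lim _ (fun n x => \sum_(k < n) \1_(F k `&` `[- N, N]%classic) x) _
      (\1_(`[- N, N]%classic))).
  + by move=> n; apply: adherent_sum => k; exact: FP.
  + move=> x; rewrite (_ : (fun n => _) = fun n : nat =>
      (\sum_(k < n) \1_(F k) x) * \1_(`[- N, N]%classic) x); last first.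
      by apply/funext => n; rewrite mulr_suml; apply: eq_bigr => k _; rewrite indI.
    rewrite indI; apply: cvgMr_tmp.
    have [[k _ Fkx]|nFx] := pselect ((\bigcup_k F k) x).
      apply: cvg_near_cst; near=> n.
      have kn : (k < n)%N by near: n; exists k.+1.
      rewrite [RHS]indicE mem_set; last by exists k.
      rewrite (bigD1 (Ordinal kn))//= indicE mem_set// big1 ?addr0// => i ik.
      rewrite indicE memNset// => Fix; move/trivIsetP : tF => /(_ i k I I).
      move=> /(_ ik)/seteqP[+ _] => /(_ x); apply; by split.
    apply: cvg_near_cst; near=> n.
    rewrite [RHS]indicE memNset// big1// => i _.
    by rewrite indicE memNset// => Fix; apply: nFx; exists i.
  + exact: sq1.
  + move=> n x; rewrite ger0_norm; last by apply: sumr_ge0.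
    under eq_bigr do rewrite indI.
    rewrite -mulr_suml ler_piMl//.
    have [[k kn Fkx]|nFx] := pselect (exists2 k : 'I_n, True & F k x).
      rewrite (bigD1 k)//= indicE mem_set// big1 ?addr0// => i ik.
      rewrite indicE memNset// => Fix; move/trivIsetP : tF => /(_ i k I I).
      by move=> /(_ ik)/seteqP[+ _] => /(_ x); apply; split.
    rewrite big1// => i _; rewrite indicE memNset// => Fix.
    by apply: nFx; exists i.
- exact: (eq_ind _ (fun S : set (set R) => S A) mA _ (RGenCInfty.measurableE R)).
Unshelve. all: end_near. Qed.

(** Simple approximations from below, cut to [-n, n], are combinations of truncated indicators
    dominated by f itself. *)
Lemma adherent_ge0 (f : R -> R) : measurable_fun setT f -> (forall x, 0 <= f x) ->
  mu.-integrable setT (EFin \o (fun x => f x ^+ 2)) -> adherent f.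
Proof.
move=> mf f0 fi; have mf' : measurable_fun setT (EFin \o f) by exact/measurable_EFinP.
have f0' x : setT x -> (0 <= (EFin \o f) x)%E by rewrite /= lee_fin.
pose h n := nnsfun_approx measurableT mf' n.
have hf x : h n x @[n --> \oo] --> f x.
  by have /fine_cvgP[_] := cvg_nnsfun_approx measurableT mf' f0' (I : setT x).
have hle n x : h n x <= f x.
  rewrite -lee_fin /h nnsfun_approxE.
  exact: (le_approx n f0' (I : setT x)).
apply: (@adherent_lim _ (fun n x => h n x * \1_(`[- n%:R, n%:R]%classic) x) _ f) => //.
- move=> n; rewrite (_ : (fun _ => _) = fun x =>
    \sum_(y <- finmap.enum_fset (fset_set (range (h n))))
      y * \1_(h n @^-1` [set y] `&` `[- n%:R, n%:R]%classic) x).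
    apply: adherent_sum => y; apply: adherent_scale; apply: adherent_indic.
    exact: measurable_sfunP.
  apply/funext => x; rewrite fimfunE fsbig_finite//= mulr_suml.
  by apply: eq_bigr => y _; rewrite -mulrA !indicE in_setI -natrM mulnb.
- move=> x; rewrite -[X in _ --> X]mulr1; apply: cvgM; first exact: hf.
  apply: cvg_near_cst; near=> n; rewrite indicE mem_set//= in_itv /= -ler_norml.
  by rewrite ltW//; near: n; exact: nbhs_infty_gtr.
- move=> n x; rewrite normrM !ger0_norm//.
  by apply: le_trans (hle n x); rewrite ler_piMr// indicE; case: (_ \in _).
Unshelve. all: end_near. Qed.

Lemma adherent_L2 (f : R -> R) : measurable_fun setT f ->
  mu.-integrable setT (EFin \o (fun x => f x ^+ 2)) -> adherent f.
Proof.
move=> mf fi.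
have abs_le (g : R -> R) : measurable_fun setT g -> (forall x, `|g x| <= `|f x|) ->
    mu.-integrable setT (EFin \o (fun x => g x ^+ 2)).
  move=> mg gf; apply: le_integrable fi => //.
    by apply/measurable_EFinP; exact: measurable_funX.
  move=> x _ /=; rewrite lee_fin !ger0_norm ?sqr_ge0//.
  rewrite -[g x ^+ 2]real_normK ?num_real// -[f x ^+ 2]real_normK ?num_real//.
  by rewrite lerXn2r ?nnegrE.
have m1 := measurable_funrpos mf; have m2 := measurable_funrneg mf.
rewrite (_ : f = fun x => f^\+%R x + -1 * f^\-%R x).
  apply: adherent_add; last apply: adherent_scale.
    apply: (adherent_ge0 m1); first by move=> x; exact: funrpos_ge0.
    apply: abs_le => // x; rewrite ger0_norm ?funrpos_ge0//.
    by rewrite /funrpos ge_max ler_norm normr_ge0.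
  apply: (adherent_ge0 m2); first by move=> x; exact: funrneg_ge0.
  apply: abs_le => // x; rewrite ger0_norm ?funrneg_ge0//.
  by rewrite /funrneg ge_max -normrN ler_norm normr_ge0.
by rewrite -[LHS]funrposBneg; apply/funext => x; rewrite mulN1r.
Qed.

Lemma Lfun2P (f : R -> R) : f \in Lfun mu 2%:E <-> measurable_fun setT f /\
  mu.-integrable setT (EFin \o (fun x => f x ^+ 2)).
Proof.
split=> [fL|[mf /integrableP[mf2 fi]]].
  split; last exact: Lfun2_integrable_sqr.
  by have := sub_Lfun_mfun fL; rewrite inE.
rewrite inE; apply/andP; split; rewrite inE//= /finite_norm unlock.
apply: poweR_lty; apply: le_lt_trans fi.
rewrite le_eqVlt; apply/orP; left; apply/eqP; apply: eq_integral => x _ /=.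
by rewrite ?poweR_EFin powR_mulrn// real_normK ?num_real// ger0_norm// sqr_ge0.
Qed.

Definition sqn (z : C) : R := Re z ^+ 2 + Im z ^+ 2.

Lemma sqn_ge0 z : 0 <= sqn z. Proof. by rewrite addr_ge0// sqr_ge0. Qed.

Lemma L2normE (f : R -> C) :
  L2norm f = fine ((\int[mu]_x (sqn (f x))%:E) `^ 2^-1)%E.
Proof.
rewrite /L2norm unlock; congr (fine (_ `^ _)%E); apply: eq_integral => x _.
rewrite /= ?poweR_EFin powR_mulrn// /sqn; case: (f x) => a c /=.
by rewrite ger0_norm ?sqrtr_ge0// sqr_sqrtr// addr_ge0// sqr_ge0.
Qed.

Lemma W_dense : L2dense [set onR w | w in @W R].
Proof.
move=> f [/Lfun2P[m1 i1] /Lfun2P[m2 i2]] e e0.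
have d0 : 0 < e ^+ 2 / 2 by rewrite divr_gt0// exprn_gt0.
have [_ A1] := adherent_L2 m1 i1; have [v1 V1 l1] := A1 _ d0.
have [_ A2] := adherent_L2 m2 i2; have [v2 V2 l2] := A2 _ d0.
have [mv1 mv2] := (realW_measurable V1, realW_measurable V2).
have [w1 W1 E1] := V1; have [w2 W2 E2] := V2.
exists (onR (fun z => w1 z + 'i%C * w2 z)).
  exists (fun z => w1 z + 'i%C * w2 z) => //.
  apply/W_gspan; apply: gspan_add; first exact/W_gspan.
  by apply: gspan_scale; exact/W_gspan.
have gE x : sqn (f x - onR (fun z => w1 z + 'i%C * w2 z) x) =
    (Re (f x) - v1 x) ^+ 2 + (Im (f x) - v2 x) ^+ 2.
  rewrite /onR; have := E1 x; have := E2 x; rewrite /onR => -> ->.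
  by rewrite /sqn; case: (f x) => a c /=; ring.
rewrite L2normE; under eq_integral do rewrite gE EFinD.
have m3 := measurable_funX 2 (measurable_funB m1 mv1).
have m4 := measurable_funX 2 (measurable_funB m2 mv2).
rewrite ge0_integralD//; first last.
- exact/measurable_EFinP.
- by move=> x _; rewrite lee_fin sqr_ge0.
- exact/measurable_EFinP.
- by move=> x _; rewrite lee_fin sqr_ge0.
set I1 := (\int[mu]_x _)%E in l1 *; set I2 := (\int[mu]_x _)%E in l2 *.
have p1 : (0 <= I1)%E by apply: integral_ge0 => x _; rewrite lee_fin sqr_ge0.
have p2 : (0 <= I2)%E by apply: integral_ge0 => x _; rewrite lee_fin sqr_ge0.
have f1 : I1 \is a fin_num by rewrite ge0_fin_numE// (lt_trans l1)// ltry.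
have f2 : I2 \is a fin_num by rewrite ge0_fin_numE// (lt_trans l2)// ltry.
move: l1 l2 p1 p2; rewrite -(fineK f1) -(fineK f2) !lte_fin !lee_fin => l1 l2 p1 p2.
rewrite -EFinD poweR_EFin /= powR12_sqrt ?addr_ge0//.
by rewrite -[ltRHS](ger0_norm (ltW e0)) -sqrtr_sqr ltr_sqrt ?exprn_gt0//; lra.
Qed.

End DensityInL2.

(** * Inner products and orthogonality to W *)

Section L2Gaussian.
Variable R : realType.
Local Notation C := R[i].
Local Notation Re := complex.Re.
Local Notation Im := complex.Im.
Local Notation mu := (@lebesgue_measure R).

Lemma Re_mul_conj (z w : C) : Re (z * w^*) = Re z * Re w + Im z * Im w.
Proof. by rewrite Re_mul cRe_conj cIm_conj; ring. Qed.
Lemma Im_mul_conj (z w : C) : Im (z * w^*) = Im z * Re w - Re z * Im w.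
Proof. by rewrite Im_mul cRe_conj cIm_conj; ring. Qed.

Lemma ae_imp (P Q : R -> Prop) : (forall x, P x -> Q x) ->
  {ae mu, forall x, P x} -> {ae mu, forall x, Q x}.
Proof. exact: (@filterS _ _ (ae_filter_ringOfSetsType mu)). Qed.

Lemma gdom_sqn (f : R -> C) : gdom f -> mu.-integrable setT (EFin \o (fun x => sqn (f x))).
Proof.
move=> fg; have [+ _] := gdom_integrable (gdomM fg (gdom_conj fg)).
by congr (mu.-integrable _ _); apply/funext => x /=; rewrite Re_mul_conj -!expr2.
Qed.

Lemma gdom_L2 (f : R -> C) : gdom f -> L2 f.
Proof.
move=> fg; have fi := gdom_sqn fg; have [[m1 m2] _] := fg.
split; apply/Lfun2P; split=> //; apply: le_integrable fi => //.
- by apply/measurable_EFinP; exact: measurable_funX.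
- by move=> x _ /=; rewrite lee_fin !ger0_norm ?sqn_ge0 ?sqr_ge0// lerDl sqr_ge0.
- by apply/measurable_EFinP; exact: measurable_funX.
- by move=> x _ /=; rewrite lee_fin !ger0_norm ?sqn_ge0 ?sqr_ge0// lerDr sqr_ge0.
Qed.

Lemma gdom_L2norm (f : R -> C) : gdom f ->
  L2norm f = Num.sqrt (\int[mu]_x sqn (f x)).
Proof.
move=> /gdom_sqn fi; rewrite L2normE /Rintegral.
have fin : (\int[mu]_x (sqn (f x))%:E)%E \is a fin_num.
  exact: (integrable_fin_num measurableT fi).
rewrite -[X in (X `^ _)%E](fineK fin) poweR_EFin /= powR12_sqrt//.
by apply: fine_ge0; apply: integral_ge0 => x _; rewrite lee_fin sqn_ge0.
Qed.

Lemma sqn_amgm (z w : C) s : 0 < s ->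
  `|Re (z * w^*)| <= s / 2 * sqn z + s^-1 / 2 * sqn w /\
  `|Im (z * w^*)| <= s / 2 * sqn z + s^-1 / 2 * sqn w.
Proof.
move=> s0; rewrite Re_mul_conj Im_mul_conj /sqn; case: z w => a1 a2 [c1 c2] /=.
have sq (u v : R) : 0 <= s * u ^+ 2 + s^-1 * v ^+ 2 + 2 * (u * v).
  have -> : s * u ^+ 2 + s^-1 * v ^+ 2 + 2 * (u * v) = s * (u + s^-1 * v) ^+ 2.
    by field; rewrite gt_eqF.
  by rewrite mulr_ge0 ?sqr_ge0// ltW.
have := sq a1 c1; have := sq a2 c2; have := sq (- a1) c1; have := sq (- a2) c2.
have := sq a1 c2; have := sq a2 c1; have := sq (- a1) c2; have := sq (- a2) c1.
rewrite !sqrrN => *; rewrite !ler_norml; split; apply/andP; split; lra.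
Qed.

Lemma normc_le_n1 (z : C) : Normc.normc z <= norm1 z.
Proof.
case: z => a c; rewrite /Normc.normc /norm1 /=.
rewrite -(@ler_sqr _ (Num.sqrt _)) ?nnegrE ?sqrtr_ge0 ?addr_ge0// sqr_sqrtr; last first.
  by rewrite addr_ge0// sqr_ge0.
rewrite sqrrD !real_normK ?num_real// lerD2r lerDl.
by rewrite mulrn_wge0// mulr_ge0.
Qed.

(** Any bound linear in [L2norm g] serves the Schwartz condition, so weighted arithmetic-geometric
    means replace Cauchy-Schwarz. The weight is slightly above the norm of g, so as to be positive
    even when that norm is 0. *)
Lemma inner_le (f g : R -> C) : gdom f -> gdom g ->
  Normc.normc (L2inner f g) <= (\int[mu]_x sqn (f x) + 1) * L2norm g.
Proof.
move=> fg gg; rewrite (gdom_L2norm gg); set F := \int[mu]_x _; set N := \int[mu]_x _.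
have F0 : 0 <= F by apply: Rintegral_ge0 => x _; exact: sqn_ge0.
have N0 : 0 <= N by apply: Rintegral_ge0 => x _; exact: sqn_ge0.
have [i1 i2] := gdom_integrable (gdomM fg (gdom_conj gg)).
have [fi gi] := (gdom_sqn fg, gdom_sqn gg).
have key s : 0 < s -> Normc.normc (L2inner f g) <= s * F + s^-1 * N.
  move=> s0; apply: le_trans (normc_le_n1 _) _.
  pose G x := s / 2 * sqn (f x) + s^-1 / 2 * sqn (g x).
  have Gi1 : mu.-integrable setT (EFin \o (fun x => s / 2 * sqn (f x))).
    exact: (integrableZl measurableT (s / 2) fi).
  have Gi2 : mu.-integrable setT (EFin \o (fun x => s^-1 / 2 * sqn (g x))).
    exact: (integrableZl measurableT (s^-1 / 2) gi).
  have Gi : mu.-integrable setT (EFin \o G) by exact: (integrableD measurableT Gi1 Gi2).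
  have GE : \int[mu]_x G x = (s * F + s^-1 * N) / 2.
    by rewrite RintegralD// !RintegralZl// -/F -/N; field; rewrite gt_eqF.
  have B (h : R -> R) : mu.-integrable setT (EFin \o h) -> (forall x, `|h x| <= G x) ->
      `|\int[mu]_x h x| <= (s * F + s^-1 * N) / 2.
    move=> hi hG; rewrite -GE; apply: le_trans (le_normr_Rintegral measurableT hi) _.
    by apply: le_Rintegral => //; exact: (integrable_abse hi).
  rewrite -[leRHS](@divfK _ 2)// mulr_natr mulr2n; apply: lerD.
    by apply: B i1 _ => x; have [] := sqn_amgm (f x) (g x) s0.
  by apply: B i2 _ => x; have [] := sqn_amgm (f x) (g x) s0.
apply/ler_addgt0Pr => e e0; set n := Num.sqrt N.
have n0 : 0 <= n by exact: sqrtr_ge0.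
have n2 : N = n ^+ 2 by rewrite sqr_sqrtr.
have F1 : 0 < F + 1 by rewrite ltr_wpDl.
have d0 : 0 < e / (F + 1) by rewrite divr_gt0.
have s0 : 0 < n + e / (F + 1) by rewrite ltr_wpDl.
apply: le_trans (key _ s0) _.
have -> : (F + 1) * n + e = (n + e / (F + 1)) * F + (n + e / (F + 1)).
  by field; rewrite gt_eqF.
rewrite lerD2l mulrC ler_pdivrMr// n2 -expr2 lerXn2r ?nnegrE ?lerDl// ltW//.
Qed.

(** By Pythagoras, every w in W is at distance at least the norm of h from h; for nonzero h this
    contradicts density. *)
Lemma orthogonal_W (h : R -> C) : gdom h ->
  (forall w, W w -> L2inner h (onR w) = 0) -> {ae mu, forall x, h x = 0}.
Proof.
move=> hg orth; have hi := gdom_sqn hg.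
have [[mh1 mh2] _] := hg.
have I0 : 0 <= \int[mu]_x sqn (h x) by apply: Rintegral_ge0 => x _; exact: sqn_ge0.
suff Ih : \int[mu]_x sqn (h x) = 0.
  have : (\int[mu]_(x in setT) `|(sqn (h x))%:E|)%E = 0%E.
    under eq_integral do rewrite abse_EFin ger0_norm ?sqn_ge0//.
    rewrite -(fineK (integrable_fin_num measurableT hi)); congr EFin.
    exact: Ih.
  move/(ae_eq_integral_abs mu measurableT); case/integrableP : hi => mhi _.
  move=> /(_ mhi); apply: ae_imp => x /(_ Logic.I) [] /eqP.
  rewrite paddr_eq0 ?sqr_ge0// !sqrf_eq0 => /andP[/eqP h1 /eqP h2].
  exact: complexP.
apply/eqP; rewrite eq_le I0 andbT leNgt; apply/negP => Ipos.
have s0 : 0 < Num.sqrt (\int[mu]_x sqn (h x)) by rewrite sqrtr_gt0.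
have [_ [w wW <-]] := W_dense (gdom_L2 hg) s0.
have wg := CW_gdom (W_CW wW).
have hwg : gdom (fun x => h x - onR w x).
  have := gdomD hg (gdomZ (-1) wg).
  by congr gdom; apply/funext => x; rewrite mulN1r.
rewrite (gdom_L2norm hwg) ltr_sqrt//; apply/negP; rewrite -leNgt.
have [i1 _] := gdom_integrable (gdomM hg (gdom_conj wg)).
have wi := gdom_sqn wg.
have E x : sqn (h x - onR w x) = (sqn (h x) + sqn (onR w x)) + (- 2) * Re (h x * (onR w x)^*).
  by rewrite Re_mul_conj /sqn; case: (h x) (onR w x) => a1 a2 [c1 c2] /=; ring.
under [leRHS]eq_Rintegral do rewrite E.
rewrite RintegralD//; first last.
- exact: (integrableZl measurableT (-2) i1).
- exact: (integrableD measurableT hi wi).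
rewrite RintegralZl// (_ : \int[mu]_x Re (h x * (onR w x)^*) = 0); last first.
  by have := congr1 (@complex.Re R) (orth _ wW).
rewrite mulr0 addr0 RintegralD// lerDl.
by apply: Rintegral_ge0 => x _; exact: sqn_ge0.
Qed.

Lemma cint_ae (f g : R -> C) : cmeas f -> cmeas g ->
  {ae mu, forall x, f x = g x} -> cint f = cint g.
Proof.
move=> [f1 f2] [g1 g2] fg; rewrite /cint /Rintegral.
congr (fine _ +i* fine _); apply: ae_eq_integral => //;
  try exact/measurable_EFinP; by move: fg; apply: ae_imp => x /= ->.
Qed.

End L2Gaussian.

(** * Representations and isomorphisms on the Gaussian space *)

Section GaussianRepresentations.
Variable R : realType.
Local Notation C := R[i].
Local Notation Re := complex.Re.
Local Notation Im := complex.Im.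
Local Notation mu := (@lebesgue_measure R).
Variable b : R.

Definition gaussians : set (R -> C) := [set onR f | f in CW].

Lemma CW_L2 (f : C -> C) : CW f -> L2 (onR f).
Proof. by move=> /CW_gdom/gdom_L2. Qed.

Lemma acts_wop (rho : Bgen -> ncexpr C (Wgen R)) (u : calB b) f : CW f ->
  acts rho u (onR f) (onR (rep_op rho u f)).
Proof.
move=> fW; split; first by apply/CW_L2/CW_wop.
by move=> w /W_CW wW; exact: wop_adj.
Qed.

Lemma gaussians_rep_domain (rho : Bgen -> ncexpr C (Wgen R)) :
  rep_domain b rho gaussians.
Proof.
split.
- split; first by move=> w /W_CW wW; exists w.
  move=> _ [f fW <-]; split; first exact: CW_L2.
  (* With the adjoint moved to the fixed f, the inner product depends on w itself and is bounded by
     its norm. *)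
  move=> u; pose f' := wop (wadj (subst rho (repr u))) f.
  have f'W : CW f' by exact: CW_wop.
  exists (\int[mu]_x sqn (onR f' x) + 1) => w /W_CW wW.
  rewrite /rep_op -[X in wop X w]wadjK -wop_adj//.
  by apply: inner_le; exact: CW_gdom.
- move=> f /W_dense H e /H [_ [w wW <-] lt]; exists (onR w) => //.
  by exists w => //; exact: W_CW.
- by move=> u w /W_CW wW; exact: acts_wop.
- move=> c _ _ [f fW <-] [g gW <-]; exists (fun z => c * f z + g z) => //.
  by apply: gspan_add => //; exact: gspan_scale.
- move=> u _ [f fW <-]; exists (onR (rep_op rho u f)); last exact: acts_wop.
  by exists (rep_op rho u f) => //; exact: CW_wop.
Qed.

Section Isomorphism.
Variables (rho1 rho2 : Bgen -> ncexpr C (Wgen R)) (om ka : C) (kern : R -> R -> C).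
Hypothesis Re_om : Re om = 0.
Hypothesis om2 : om ^+ 2 = - (pi ^+ 2)%:C.
Hypothesis kernE : forall x y, kern x y = gker om ka (x%:C - y%:C).
Hypothesis gconv_gen : forall g f, CW f ->
  gconv om ka (wop (rho1 g) f) = wop (rho2 g) (gconv om ka f).

Lemma int_op_gconv f : int_op kern (onR f) = onR (gconv om ka f).
Proof.
apply/funext => y; rewrite /int_op /onR /gconv.
by congr cint; apply/funext => x; rewrite kernE.
Qed.

Lemma gconv_wop (e : ncexpr C Bgen) f : CW f ->
  gconv om ka (wop (subst rho1 e) f) = wop (subst rho2 e) (gconv om ka f).
Proof.
elim: e f => [c|g|u IHu v IHv|u IHu v IHv] f fW /=.
- exact: gconvZ.
- exact: gconv_gen.
- by rewrite gconvD ?IHu ?IHv//; exact: CW_wop.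
- by rewrite IHu ?IHv//; exact: CW_wop.
Qed.

Lemma kern_cmeas y f : CW f -> cmeas (fun x => kern x y * onR f x).
Proof.
move=> fW; have [+ _] := CW_gdom (CW_gker ka Re_om y%:C fW).
by congr cmeas; apply/funext => x; rewrite kernE.
Qed.

Lemma int_op_ae f g y : CW f -> CW g -> ae_eqL2 (onR f) (onR g) ->
  int_op kern (onR f) y = int_op kern (onR g) y.
Proof.
move=> fW gW fg; apply: cint_ae; try exact: kern_cmeas.
by apply: ae_imp fg => x ->.
Qed.

Lemma gconv_rep_iso : rep_iso b rho1 rho2 gaussians gaussians kern.
Proof.
have Re_om' : Re (- om) = 0 by move: Re_om; case: (om) => ? ? /= ->; rewrite oppr0.
have om2' : (- om) ^+ 2 = - (pi ^+ 2)%:C by rewrite sqrrN.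
split.
- split=> [_ [f fW <-] y|_ [f fW <-]].
    have := gconv_cintegrable ka Re_om y%:C fW.
    by congr cintegrable; apply/funext => x; rewrite kernE.
  by rewrite int_op_gconv; exists (gconv om ka f) => //; exact: CW_gconv.
- move=> c _ _ [f fW <-] [g gW <-]; apply: aeW => y.
  have cfW : CW (fun z => c * f z) by exact: gspan_scale.
  rewrite (_ : (fun x : R => _) = onR (fun z => c * f z + g z))//.
  by rewrite !int_op_gconv gconvD// gconvZ.
- split=> [_ _ [f fW <-] [g gW <-]|_ [g gW <-]].
    rewrite !int_op_gconv => fg; apply: aeW => y.
    (* The inverse convolution recovers f and g pointwise from integrals that ignore null sets. *)
    rewrite /onR -(gconvK ka Re_om om2 fW) -(gconvK ka Re_om om2 gW).
    have [fW' gW'] := (CW_gconv ka Re_om om2 fW, CW_gconv ka Re_om om2 gW).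
    apply: cint_ae; last by apply: ae_imp fg => x; rewrite /onR => ->.
      by have [] := CW_gdom (CW_gker ka Re_om' y%:C fW').
    by have [] := CW_gdom (CW_gker ka Re_om' y%:C gW').
  exists (onR (gconv (- om) ka g)).
    by exists (gconv (- om) ka g) => //; exact: CW_gconv.
  by apply: aeW => y; rewrite int_op_gconv -{1}(opprK om) gconvK.
- move=> u _ _ [f fW <-] [g gW <-] [gL2 fg].
  have uW : CW (rep_op rho1 u f) by exact: CW_wop.
  have hg : gdom (fun x => onR g x + -1 * onR (rep_op rho1 u f) x).
    by apply: gdomD; [exact: CW_gdom|apply: gdomZ; exact: CW_gdom].
  (* [acts] pairs g with W only: the difference of the two sides is orthogonal to W. The integral
     operator then takes the same values on both at every point. *)
  have gE : ae_eqL2 (onR g) (onR (rep_op rho1 u f)).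
    have /(orthogonal_W hg) : forall w, W w ->
        L2inner (fun x => onR g x + -1 * onR (rep_op rho1 u f) x) (onR w) = 0.
      move=> w wW; rewrite /L2inner.
      under [X in cint X]eq_fun do rewrite mulrDl -mulrA.
      have i1 := inner_integrable gW (W_CW wW).
      have i2 := inner_integrable uW (W_CW wW).
      rewrite cintD//; last exact: cintegrableZ.
      rewrite cintZ// mulN1r; apply/eqP; rewrite subr_eq0; apply/eqP.
      have := fg w wW; rewrite /L2inner => ->.
      by rewrite -[RHS]/(L2inner _ _) wop_adj//; exact: W_CW.
    by apply: ae_imp => x /eqP; rewrite mulN1r subr_eq0 => /eqP.
  rewrite (_ : int_op kern (onR g) = onR (rep_op rho2 u (gconv om ka f))).
    by rewrite int_op_gconv; apply: acts_wop; exact: CW_gconv.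
  apply/funext => y; rewrite (int_op_ae y gW uW gE) int_op_gconv.
  by rewrite /rep_op gconv_wop.
Qed.

End Isomorphism.

End GaussianRepresentations.

(** * Intertwining of the generators *)

Section Intertwiners.
Variable R : realType.
Local Notation C := R[i].
Local Notation Re := complex.Re.
Variable b : R.
Hypothesis b_gt0 : 0 < b.

Definition pii : C := 0 +i* pi.
Definition kap : C := (2 * pi * apar b)%:C.

Lemma Re_pii : Re pii = 0. Proof. by []. Qed.
Lemma pii2 : pii ^+ 2 = - (pi ^+ 2)%:C.
Proof. by apply: complexP; rewrite expr2 /=; ring. Qed.

Lemma cexp_pii : cexp pii = -1.
Proof.
by apply: complexP; rewrite ?Re_cexp ?Im_cexp /= expR0 mul1r ?cospi ?sinpi// oppr0.
Qed.

Lemma cexp_Npii : cexp (- pii) = -1.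
Proof.
apply: complexP; rewrite ?Re_cexp ?Im_cexp /= oppr0 expR0 mul1r ?cosN ?cospi//.
by rewrite sinN sinpi !oppr0.
Qed.

Lemma kern_C'E x y : kern_C' b x y = gker pii kap (x%:C - y%:C).
Proof.
rewrite /kern_C' /kern_k /gker [(x%:C - y%:C) ^+ 2]expr2; congr cexp.
by apply: complexP; rewrite /=; ring.
Qed.

Lemma kern_D'E x y : kern_D' b x y = gker (- pii) kap (x%:C - y%:C).
Proof.
rewrite /kern_D' /kern_K /gker [(x%:C - y%:C) ^+ 2]expr2; congr cexp.
by apply: complexP; rewrite /=; ring.
Qed.

Lemma kern_lCE x y : kern_lC b x y = gker pii (- kap) (x%:C - y%:C).
Proof.
rewrite /kern_lC /kern_k /gker [(x%:C - y%:C) ^+ 2]expr2; congr cexp.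
by apply: complexP; rewrite /=; ring.
Qed.

Lemma kern_lDE x y : kern_lD b x y = gker (- pii) (- kap) (x%:C - y%:C).
Proof.
rewrite /kern_lD /kern_K /gker [(x%:C - y%:C) ^+ 2]expr2; congr cexp.
by apply: complexP; rewrite /=; ring.
Qed.

(** As a is symmetric under exchange of b and 1/b, one computation serves the plain and the tilded
    generators. *)
Lemma kapM (d : R) : d = b \/ d = b^-1 -> kap * d%:C = pi%:C * (d%:C * d%:C + 1).
Proof.
move=> dE; rewrite -real_complexM -[1](_ : 1%:C = _)// -real_complexD.
rewrite -!real_complexM /kap /apar; congr (_%:C).
by case: dE => ->; field; rewrite gt_eqF.
Qed.

Let ie : C := 'i%C.
Let ie2 : ie ^+ 2 = -1. Proof. exact: sqr_i. Qed.
Let piiE : pii = pi%:C * ie. Proof. by apply: complexP; rewrite /=; ring. Qed.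
Let imE (d : R) : d *i = d%:C * ie. Proof. by apply: complexP; rewrite /=; ring. Qed.

(** The cross term of the shifted square turns exp(2 pi d z) into exp(2 pi d x). With the sign
    written as exp(pi i), the remaining phase is i (pi (d^2 + 1) - 2 pi a d), zero by [kapM]. *)
Lemma gker_rdual (d : R) (x z : C) : d = b \/ d = b^-1 ->
  cexp ((2 * pi * d)%:C * x) * gker pii kap (x - z) =
  - (cexp ((2 * pi * d)%:C * (z + d *i)) * gker pii kap (x - (z + d *i))).
Proof.
move=> /kapM h; rewrite /gker -[RHS]mulN1r -cexp_pii -!cexpD !real_complexM !rmorph_nat !imE !piiE.
congr cexp; apply/eqP; rewrite eq_sym -subr_eq0; apply/eqP.
(* [ie] is an atom for [ring]; the difference is exhibited as a combination of the relations [kapM]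
   and i^2 = -1. *)
transitivity (ie * (pi%:C * (d%:C * d%:C + 1) - kap * d%:C) +
  (ie ^+ 2 + 1) * (pi%:C * d%:C * d%:C * ie - 2 * pi%:C * d%:C * (x - z))).
  by ring.
by rewrite h ie2 subrr addNr mulr0 mul0r addr0.
Qed.

(** The opposite sign of [ka] reverses the remaining phase, so here the sign is written as exp(-pi
    i). *)
Lemma gker_ldual (d : R) (x z : C) : d = b \/ d = b^-1 ->
  cexp ((2 * pi * d)%:C * x) * gker pii (- kap) (x - z) =
  - (cexp ((2 * pi * d)%:C * z) * gker pii (- kap) (x - (z + d *i))).
Proof.
move=> /kapM h; rewrite /gker -[RHS]mulN1r -cexp_Npii -!cexpD !real_complexM !rmorph_nat !imE !piiE.
congr cexp; apply/eqP; rewrite eq_sym -subr_eq0; apply/eqP.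
transitivity (- ie * (pi%:C * (d%:C * d%:C + 1) - kap * d%:C) +
  (ie ^+ 2 + 1) * (pi%:C * d%:C * d%:C * ie - 2 * pi%:C * d%:C * (x - z))).
  by ring.
by rewrite h ie2 subrr addNr mulr0 mul0r addr0.
Qed.

Lemma gconv_rdual g f : CW f ->
  gconv pii kap (wop (rep_pi b g) f) = wop (rep_rdual b g) (gconv pii kap f).
Proof.
move=> fW.
have Y d : d = b \/ d = b^-1 -> gconv pii kap (fun z => cexp ((2 * pi * d)%:C * z) * f z) =
    fun z => -1 * (cexp ((2 * pi * d)%:C * (z + d *i)) * gconv pii kap f (z + d *i)).
  move=> dE; apply/funext => z; rewrite /gconv mulrA -cintZ; last first.
    exact: gconv_cintegrable.
  congr cint; apply/funext => x.
  move: (gker_rdual x%:C z dE).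
  by move: (cexp _) (gker _ _ _) (cexp _) (gker _ _ _) => c1 g1 c2 g2 e; ring: e.
case: g => /=; [exact: gconv_shift|by apply: Y; left|exact: gconv_shift|].
by apply: Y; right.
Qed.

Lemma gconv_ldual g f : CW f ->
  gconv pii (- kap) (wop (rep_pi b g) f) = wop (rep_ldual b g) (gconv pii (- kap) f).
Proof.
move=> fW.
have Y d : d = b \/ d = b^-1 -> gconv pii (- kap) (fun z => cexp ((2 * pi * d)%:C * z) * f z) =
    fun z => -1 * (cexp ((2 * pi * d)%:C * z) * gconv pii (- kap) f (z + d *i)).
  move=> dE; apply/funext => z; rewrite /gconv mulrA -cintZ; last first.
    exact: gconv_cintegrable.
  congr cint; apply/funext => x.
  move: (gker_ldual x%:C z dE).
  by move: (cexp _) (gker _ _ _) (cexp _) (gker _ _ _) => c1 g1 c2 g2 e; ring: e.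
case: g => /=; [exact: gconv_shift|by apply: Y; left|exact: gconv_shift|].
by apply: Y; right.
Qed.

(** Conjugation by the two-sided inverse: the relations for D' and 'D follow from those for C' and
    'C. *)
Lemma gconv_inverse rho1 rho2 (om ka : C) : Re om = 0 -> om ^+ 2 = - (pi ^+ 2)%:C ->
  (forall g f, CW f ->
    gconv om ka (wop (rho1 g) f) = wop (rho2 g) (gconv om ka f)) ->
  forall (g : Bgen) f, CW f ->
    gconv (- om) ka (wop (rho2 g) f) = wop (rho1 g) (gconv (- om) ka f).
Proof.
move=> Re_om om2 H g f fW.
have Re_om' : Re (- om) = 0 by move: Re_om; case: (om) => ? ? /= ->; rewrite oppr0.
have om2' : (- om) ^+ 2 = - (pi ^+ 2)%:C by rewrite sqrrN.
have f'W : CW (gconv (- om) ka f) by exact: CW_gconv.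
rewrite -{1}(gconvK ka Re_om' om2' fW) opprK -H// gconvK//.
exact: CW_wop.
Qed.

End Intertwiners.

Theorem proposition4p11 (R : realType) (b : R) (b_gt0 : 0 < b)
    (b2_irrational : forall r : rat, b ^+ 2 <> ratr r) :
  exists D Dr Dl : set (R -> R[i]),
    [/\ rep_domain b (rep_pi b) D,
        rep_domain b (rep_rdual b) Dr &
        rep_domain b (rep_ldual b) Dl] /\
    [/\ rep_iso b (rep_pi b) (rep_rdual b) D Dr (kern_C' b),
        rep_iso b (rep_rdual b) (rep_pi b) Dr D (kern_D' b),
        rep_iso b (rep_pi b) (rep_ldual b) D Dl (kern_lC b) &
        rep_iso b (rep_ldual b) (rep_pi b) Dl D (kern_lD b)] /\
    [/\ (forall f, D f ->
          ae_eqL2 (int_op (kern_D' b) (int_op (kern_C' b) f)) f),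
        (forall f, Dr f ->
          ae_eqL2 (int_op (kern_C' b) (int_op (kern_D' b) f)) f),
        (forall f, D f ->
          ae_eqL2 (int_op (kern_lD b) (int_op (kern_lC b) f)) f) &
        (forall f, Dl f ->
          ae_eqL2 (int_op (kern_lC b) (int_op (kern_lD b) f)) f)].
Proof.
have Rp := Re_pii R; have p2 := pii2 R.
have iC' := gconv_rdual b_gt0; have iD' := gconv_inverse Rp p2 iC'.
have ilC := gconv_ldual b_gt0; have ilD := gconv_inverse Rp p2 ilC.
have Re_Npii : complex.Re (- pii R) = 0 by rewrite /= oppr0.
have Npii2 : (- pii R) ^+ 2 = - (pi ^+ 2)%:C by rewrite sqrrN p2.
have KC := gconvK _ Rp p2; have KD := gconvK _ Re_Npii Npii2.
exists (@gaussians R), (@gaussians R), (@gaussians R); split; [split|split;[split|split]].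
- exact: gaussians_rep_domain.
- exact: gaussians_rep_domain.
- exact: gaussians_rep_domain.
- exact: (gconv_rep_iso b Rp p2 (kern_C'E b) iC').
- exact: (gconv_rep_iso b Re_Npii Npii2 (kern_D'E b) iD').
- exact: (gconv_rep_iso b Rp p2 (kern_lCE b) ilC).
- exact: (gconv_rep_iso b Re_Npii Npii2 (kern_lDE b) ilD).
- move=> _ [f fW <-]; rewrite (int_op_gconv (kern_C'E b)) (int_op_gconv (kern_D'E b)).
  by rewrite KC//; apply: aeW.
- move=> _ [f fW <-]; rewrite (int_op_gconv (kern_D'E b)) (int_op_gconv (kern_C'E b)).
  by rewrite -[X in gconv X _ (gconv _ _ _)]opprK KD//; apply: aeW.
- move=> _ [f fW <-]; rewrite (int_op_gconv (kern_lCE b)) (int_op_gconv (kern_lDE b)).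
  by rewrite KC//; apply: aeW.
- move=> _ [f fW <-]; rewrite (int_op_gconv (kern_lDE b)) (int_op_gconv (kern_lCE b)).
  by rewrite -[X in gconv X _ (gconv _ _ _)]opprK KD//; apply: aeW.
Qed.
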